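(* Let $d\ge3$ and consider the $d$-dimensional integer lattice $\mathcal{V}=\{1,\dots,m\}^d$ seen as a torus. Let $\mathcal{C}$ denote the class of self-avoiding paths of length $k\le m$ (i.e. with $k$ nodes) in $\mathcal{V}$ starting at a known location $v_0\in\mathcal{V}$. Assume the autocorrelation coefficient $\psi\in(-1,1)$ is fixed. There exist constants $0<C_1\le C_2<1$ depending only on $d$ such that, when $|\psi|<C_1$, \[ \liminf_{k\to\infty}R^*_{\mathcal{C},\psi}>0, \] while, when $|\psi|>C_2$, \[ \lim_{k\to\infty}R^*_{\mathcal{C},\psi}=0. \] Here $k\to\infty$ with $m=m(k)\ge k$ arbitrary.
   Context: The lattice seen as a torus is the graph with node set $\mathcal{V}=\{1,\dots,m\}^d$, identified with $(\mathbb{Z}/m\mathbb{Z})^d$, in which two nodes are adjacent if they differ by $\pm1$ (modulo $m$) in exactly one coordinate and agree in the others. A self-avoiding path in a graph with node set $\mathcal{V}$ and edge set $\mathcal{E}$ is a finite sequence of nodes $S=(s_1,\dots,s_k)\in\mathcal{V}^k$ with $(s_j,s_{j+1})\in\mathcal{E}$ for all $j$ and $s_j\neq s_{j'}$ for $j\neq j'$. A path is also identified with its set of nodes. One observes $X=(X_i)_{i\in\mathcal{V}}$ with standard normal components. Under $\mathbb{P}_0$ (the null hypothesis) the components of $X$ are independent. For $S=(s_1,\dots,s_k)\in\mathcal{C}$ and $\psi\in(-1,1)$, under $\mathbb{P}_{S,\psi}$ the vector $(X_i)_{i\in S}$ is a stationary autoregressive process of order 1 with coefficient $\psi$, i.e.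 it is a centered Gaussian vector with $\mathrm{Cov}(X_{s_i},X_{s_j})=\psi^{|i-j|}$; the components $(X_i)_{i\notin S}$ are i.i.d. standard normal; and $(X_i)_{i\in S}$ and $(X_i)_{i\notin S}$ are independent. A test is a measurable function $f:\mathbb{R}^{\mathcal{V}}\to\{0,1\}$ (which may depend on $\psi$). The worst-case risk of $f$ and the minimax risk are \[ R_{\mathcal{C},\psi}(f)=\mathbb{P}_0\{f(X)=1\}+\max_{S\in\mathcal{C}}\mathbb{P}_{S,\psi}\{f(X)=0\},\qquad R^*_{\mathcal{C},\psi}=\inf_fR_{\mathcal{C},\psi}(f), \] where the infimum is over all tests $f$. *)

(* Defs.v *)
From mathcomp Require Export all_boot all_order all_algebra.
From mathcomp Require Export all_classical all_reals all_analysis.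
Export Order.TTheory GRing.Theory Num.Theory.
Export numFieldNormedType.Exports.

Set Implicit Arguments.
Unset Strict Implicit.
Unset Printing Implicit Defensive.

Local Open Scope classical_set_scope.
Local Open Scope ring_scope.

(* Residues modulo m are represented by 'I_m = {0, ..., m-1}. *)
Definition torus (d m : nat) : finType := {ffun 'I_d -> 'I_m}.

Definition torus_adj d m : rel (torus d m) := fun x y =>
  [exists j, (((x j).+1 == y j %[mod m]) || ((y j).+1 == x j %[mod m]))
             && [forall i, (i != j) ==> (x i == y i)]].

Definition self_avoiding_paths (V : finType) (e : rel V) (v0 : V) (k : nat) :
    {set k.-tuple V} :=
  [set S : k.-tuple V | [&& ohead S == Some v0, sorted e S & uniq S]].

Section model.
Variable R : realType.

Local Notation Rm := (measurableTypeR R).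

(* The n-fold product of a sigma-finite measure with itself, on n.-tuple R with
   the product sigma-algebra. *)
Fixpoint power_measure (mu : set Rm -> \bar R) (n : nat) :
    set (n.-tuple Rm) -> \bar R :=
  match n with
  | 0 => \d_([tuple] : 0.-tuple Rm)
  | n'.+1 => pushforward (mu \x @power_measure mu n')%E
                         (fun p => [tuple of p.1 :: p.2])
  end.

Arguments power_measure : clear implicits.

(* The law N(0, Sigma), for Sigma symmetric positive definite, by its density
   with respect to the Lebesgue measure on R^n. *)
Definition centered_gaussian_pdf n (Sigma : 'M[R]_n) (y : n.-tuple Rm) : R :=
  let u : 'rV[R]_n := \row_i tnth y i in
  (Num.sqrt ((2 * pi) ^+ n * \det Sigma))^-1
  * expR (- (u *m invmx Sigma *m u^T) 0 0 / 2).

Definition centered_gaussian n (Sigma : 'M[R]_n) : set (n.-tuple Rm) -> \bar R :=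
  fun A => (\int[power_measure lebesgue_measure n]_(y in A)
              (centered_gaussian_pdf Sigma y)%:E)%E.

Definition ar1_cov (psi : R) k : 'M[R]_k :=
  \matrix_(i < k, j < k) psi ^+ `|(i : nat) - (j : nat)|%N.

(* R^V; the coordinate of x at the node v is tnth x (enum_rank v). *)
Definition config (V : finType) := (#|V|).-tuple Rm.

Definition null_law (V : finType) : set (config V) -> \bar R :=
  power_measure (normal_prob 0 1) #|V|.

(* The field equal to y_j at the j-th node of S, and to z off S. *)
Definition glue (V : finType) k (S : k.-tuple V)
    (p : k.-tuple Rm * config V) : config V :=
  [tuple let v := enum_val i in
         if v \in S then nth 0 p.1 (index v S) else tnth p.2 i | i < #|V|].

(* Taking a product measure makes the components on S independent of those off
   S; the coordinates of the second factor on S are discarded. *)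
Definition path_law (V : finType) (psi : R) k (S : k.-tuple V) :
    set (config V) -> \bar R :=
  pushforward (centered_gaussian (ar1_cov psi k) \x @null_law V)%E (glue S).

Definition risk (V : finType) k (C : {set k.-tuple V}) (psi : R)
    (f : {mfun config V >-> bool}) : \bar R :=
  (null_law [set x | f x = true]
   + \big[maxe/-oo]_(S in C) path_law psi S [set x | f x = false])%E.

Definition minimax_risk (V : finType) k (C : {set k.-tuple V}) (psi : R) :
    \bar R :=
  ereal_inf (range (@risk V k C psi)).

End model.

(* Main.v *)
(* Everything is expressed through the density L_S of P_S with respect to P_0,
   a product of Mehler kernels along S, and every expectation is computed by
   integrating out one node at a time.

   Large |psi|: reject when L_S >= (4 d)^k for some S.  There are at most
   (2 d)^k paths and E_0 L_S = 1, so the type I error is at most 2^-k; the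
   type II error is controlled by E_0 (sqrt L_S) <= kappa^(k - 1), where
   kappa tends to 0 as |psi| tends to 1.

   Small |psi|: if L is the average of L_S under a prior, then
   1_f + 1_(not f) L >= L - L^2 / 4, so the risk is at least
   1 - E_0 (L^2) / 4.  For paths that can only meet at equal times,
   E_0 (L_S L_S') <= (1 + a)^N, with N the number of meetings and a small with
   psi.  A prior for which E (1 + a)^N <= 2 is carried by monotone paths in
   three of the coordinates, in the spirit of the unpredictable paths of
   Benjamini, Pemantle and Peres.  The steps are shared between scales: those
   of scale j have density of order 2^-j, and in each block of length of order
   8^j they are driven by fresh uniform displacements in {0, ..., 4^j - 1}, one
   for each of two coordinates.  Hence the position after g more steps,
   conditionally on the past, has atoms of mass O(g^(-4/3)), which is
   summable. *)

Require Import Defs.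
From HB Require Import structures.
From mathcomp Require Import measurable_realfun simple_functions zify ring lra.

Set Implicit Arguments.
Unset Strict Implicit.
Unset Printing Implicit Defensive.

Local Open Scope classical_set_scope.
Local Open Scope ring_scope.

(** * Measures given by a density *)

Section density.
Local Open Scope ereal_scope.
Context (d : measure_display) (T : measurableType d) (R : realType).
Variables (mu : {measure set T -> \bar R}) (g : T -> R).
Hypotheses (g0 : forall x, (0 <= g x)%R) (mg : measurable_fun setT g).

Definition density (A : set T) := \int[mu]_(x in A) (g x)%:E.

Let density0 : density set0 = 0.
Proof. by rewrite /density integral_set0. Qed.

Let density_ge0 A : 0 <= density A.
Proof. by apply: integral_ge0 => x _; rewrite lee_fin. Qed.

Let density_sigma_additive : semi_sigma_additive density.
Proof.
move=> F mF tF mUF; rewrite /density ge0_integral_bigcup//.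
- by apply: is_cvg_ereal_nneg_natsum_cond => n _ _; apply: integral_ge0 => x _; rewrite lee_fin.
- by apply/measurable_EFinP; apply: measurable_funTS.
- by move=> x _; rewrite lee_fin.
Qed.

HB.instance Definition _ := isMeasure.Build _ _ _ density
  density0 density_ge0 density_sigma_additive.

Import HBNNSimple.

(** Both sides are limits, by monotone convergence, of their values at simple functions; there each
    reduces to the sum of the values weighted by the [density] of the level sets. *)
Lemma ge0_integral_density (f : T -> \bar R) :
  (forall x, 0 <= f x) -> measurable_fun setT f ->
  \int[density]_x f x = \int[mu]_x (f x * (g x)%:E).
Proof.
move=> f0 mf; pose h := nnsfun_approx measurableT mf.
have mEg : measurable_fun setT (EFin \o g) by exact/measurable_EFinP.
have cvgh x : (EFin \o h n) x @[n --> \oo] --> f x by apply: cvg_nnsfun_approx.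
have ndh x : {homo (fun n => h n x) : m n / (m <= n)%N >-> (m <= n)%R}.
  by move=> a b ab; exact/lefP/nd_nnsfun_approx.
have -> : \int[density]_x f x = limn (fun n => \int[density]_x (h n x)%:E).
  rewrite -monotone_convergence//.
  - by apply: eq_integral => x _; apply/esym/cvg_lim => //; exact: cvgh.
  - by move=> n; exact/measurable_EFinP/measurable_funP.
  - by move=> n x _; rewrite lee_fin.
  - by move=> x _ a b ab; rewrite lee_fin ndh.
have -> : \int[mu]_x (f x * (g x)%:E) =
    limn (fun n => \int[mu]_x ((h n x)%:E * (g x)%:E)).
  rewrite -monotone_convergence//.
  - apply: eq_integral => x _; apply/esym/cvg_lim => //.
    by apply: cvgeZr => //; exact: cvgh.
  - move=> n; apply: emeasurable_funM => //.
    exact/measurable_EFinP/measurable_funP.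
  - by move=> n x _; rewrite mule_ge0 ?lee_fin.
  - by move=> x _ a b ab; rewrite lee_wpmul2r ?lee_fin ?ndh.
congr (limn _); apply/funext => n.
transitivity (\sum_(y \in range (h n)) y%:E * density (h n @^-1` [set y])).
  under eq_integral do rewrite fimfunE -fsumEFin//.
  rewrite ge0_integral_fsum//; last 2 first.
  - by move=> y; exact/measurable_EFinP/measurable_funM.
  - by move=> y x _; exact: nnfun_muleindic_ge0.
  apply: eq_fsbigr => y _.
  by rewrite integralZl_indic_nnsfun// integral_indic ?setIT.
under [RHS]eq_integral => x _.
  rewrite [in X in X * _]fimfunE -fsumEFin//.
  rewrite ge0_mule_fsuml; last by move=> y; exact: nnfun_muleindic_ge0.
  over.
rewrite ge0_integral_fsum//; last 2 first.
- move=> y; apply: emeasurable_funM => //.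
  by exact/measurable_EFinP/measurable_funM.
- by move=> y x _; rewrite mule_ge0 ?lee_fin// -lee_fin nnfun_muleindic_ge0.
apply: eq_fsbigr => y yh.
have y0 : (0 <= y)%R by move: yh; rewrite inE => -[t _ <-].
under eq_integral do rewrite EFinM -muleA.
rewrite ge0_integralZl//.
- congr (_ * _); rewrite /density integral_mkcond.
  apply: eq_integral => x _; rewrite patchE indicE.
  by case: ifPn; rewrite ?mul1e ?mul0e.
- by apply: emeasurable_funM => //; exact/measurable_EFinP.
- by move=> x _; rewrite mule_ge0 ?lee_fin.
Qed.

End density.

(** * Power measures *)

Section power.
Local Open Scope ereal_scope.
Variable R : realType.
Local Notation Rm := (measurableTypeR R).

Definition cons_pair n (p : Rm * n.-tuple Rm) : n.+1.-tuple Rm :=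
  [tuple of p.1 :: p.2].

Lemma measurable_cons_pair n : measurable_fun setT (@cons_pair n).
Proof. exact: measurable_cons. Qed.

Section cons_push.
Variables (n : nat) (mu : {sigma_finite_measure set Rm -> \bar R})
  (nu : {sigma_finite_measure set (n.-tuple Rm) -> \bar R}).

Definition cons_measure := pushforward (mu \x nu) (@cons_pair n).

Let mcons A : measurable A -> measurable (@cons_pair n @^-1` A).
Proof. by move=> mA; rewrite -[X in measurable X]setTI; exact: measurable_cons_pair. Qed.

Let cons_measure0 : cons_measure set0 = 0.
Proof. by rewrite /cons_measure /pushforward preimage_set0 measure0. Qed.

Let cons_measure_ge0 A : 0 <= cons_measure A.
Proof. by rewrite /cons_measure /pushforward; exact: measure_ge0. Qed.

Let cons_measure_sigma_additive : semi_sigma_additive cons_measure.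
Proof.
move=> F mF tF mUF; rewrite /cons_measure /pushforward preimage_bigcup.
apply: measure_semi_sigma_additive; first by move=> k; exact: mcons.
- apply/trivIsetP => /= i j _ _ ij; rewrite -preimage_setI.
  by move/trivIsetP : tF => /(_ _ _ _ _ ij) ->//; rewrite preimage_set0.
- by rewrite -preimage_bigcup; exact: mcons.
Qed.

HB.instance Definition _ := isMeasure.Build _ _ _ cons_measure
  cons_measure0 cons_measure_ge0 cons_measure_sigma_additive.

Let cons_measure_sigma_finite : sigma_finite setT cons_measure.
Proof.
have /sigma_finiteP[F [TF ndF Foo]] := sigma_finiteT mu.
have /sigma_finiteP[G [TG ndG Goo]] := sigma_finiteT nu.
pose hd (y : n.+1.-tuple Rm) := thead y.
pose tl (y : n.+1.-tuple Rm) := [tuple of behead y].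
have mhd : measurable_fun setT hd by exact: measurable_tnth.
have mtl : measurable_fun setT tl by exact: measurable_behead.
(* The exhausting sequences of both factors are nondecreasing, so the rectangles with equal indices
   already cover the product. *)
exists (fun k => hd @^-1` F k `&` tl @^-1` G k).
  apply/seteqP; split => // y _.
  have : [set: Rm] (hd y) by [].
  rewrite TF => -[i _ Fi].
  have : [set: n.-tuple Rm] (tl y) by [].
  rewrite TG => -[j _ Gj]; exists (maxn i j) => //; split.
  - by apply: (subsetPset _ _ (ndF _ _ (leq_maxl i j))).
  - by apply: (subsetPset _ _ (ndG _ _ (leq_maxr i j))).
move=> k; have [mF Flt] := Foo k; have [mG Glt] := Goo k; split.
  apply: measurableI.
  - by rewrite -[X in measurable X]setTI; exact: mhd.
  - by rewrite -[X in measurable X]setTI; exact: mtl.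
rewrite /cons_measure /pushforward.
rewrite (_ : _ @^-1` _ = F k `*` G k).
  by rewrite product_measure1E// lte_mul_pinfty// ge0_fin_numE.
have hdK p : hd (cons_pair p) = p.1 by rewrite /hd /cons_pair theadE.
have tlK p : tl (cons_pair p) = p.2 by apply: val_inj.
by apply/seteqP; split => p /=; rewrite hdK tlK.
Qed.

HB.instance Definition _ := Measure_isSigmaFinite.Build _ _ _ cons_measure
  cons_measure_sigma_finite.

End cons_push.

(** The set functions of [power_measure], bundled with their sigma-finiteness, which Tonelli's
    theorem requires at each induction step. *)
Fixpoint power_sfm (mu : {sigma_finite_measure set Rm -> \bar R}) n :
    {sigma_finite_measure set (n.-tuple Rm) -> \bar R} :=
  match n with
  | 0 => \d_([tuple] : 0.-tuple Rm)
  | n'.+1 => cons_measure mu (power_sfm mu n')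
  end.

Variable mu : {sigma_finite_measure set Rm -> \bar R}.

Lemma power_measureE n : @power_measure R mu n = power_sfm mu n.
Proof. by elim: n => //= n ->. Qed.

Lemma integral_power0 (F : 0.-tuple Rm -> \bar R) :
  measurable_fun setT F -> \int[power_sfm mu 0]_x F x = F [tuple].
Proof. by move=> mF; rewrite integral_dirac// diracT mul1e. Qed.

Lemma measurable_power_consr n (F : n.+1.-tuple Rm -> \bar R) y :
  measurable_fun setT F -> measurable_fun setT (fun ys => F (cons_pair (y, ys))).
Proof.
move=> mF; apply: (measurableT_comp mF).
by apply: (measurable_cons (f := cst y) (g := id)).
Qed.

Lemma measurable_power_inner n (F : n.+1.-tuple Rm -> \bar R) :
  measurable_fun setT F -> (forall x, 0 <= F x) ->
  measurable_fun setT (fun y => \int[power_sfm mu n]_ys F (cons_pair (y, ys))).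
Proof.
move=> mF F0.
apply: (measurable_fun_fubini_tonelli_F (F \o @cons_pair n)) => [|x]; last exact: F0.
exact: (measurableT_comp mF (@measurable_cons_pair n)).
Qed.

Lemma integral_powerS n (F : n.+1.-tuple Rm -> \bar R) :
  measurable_fun setT F -> (forall x, 0 <= F x) ->
  \int[power_sfm mu n.+1]_x F x =
  \int[mu]_y \int[power_sfm mu n]_ys F (cons_pair (y, ys)).
Proof.
move=> mF F0; rewrite [LHS](ge0_integral_pushforward (@measurable_cons_pair n))//.
rewrite preimage_setT (fubini_tonelli1 (F \o @cons_pair n))//; last by move=> x; exact: F0.
exact: (measurableT_comp mF (@measurable_cons_pair n)).
Qed.

End power.

(** * Resampling one coordinate of a product probability *)

Section resampling.
Local Open Scope ereal_scope.
Variable R : realType.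
Local Notation Rm := (measurableTypeR R).
Variable mu : probability Rm R.

Lemma power_sfm_setT n : power_sfm mu n setT = 1.
Proof.
rewrite -[LHS]mul1e -integral_cst//; elim: n => [|n IH].
  by rewrite integral_power0.
transitivity (\int[mu]_y cst 1 y); last by rewrite integral_cst// mul1e; exact: probability_setT.
by rewrite integral_powerS//; apply: eq_integral.
Qed.

Definition set_coord n (i : 'I_n) (x : n.-tuple Rm) (y : Rm) : n.-tuple Rm :=
  [tuple if j == i then y else tnth x j | j < n].

Lemma measurable_set_coord n (i : 'I_n) d (T : measurableType d)
    (f : T -> n.-tuple Rm) (g : T -> Rm) :
  measurable_fun setT f -> measurable_fun setT g ->
  measurable_fun setT (fun t => set_coord i (f t) (g t)).
Proof.
move=> mf mg; apply/measurable_fun_tnthP => j.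
under [X in measurable_fun _ X]eq_fun do rewrite /= tnth_mktuple.
case: eqP => // _; exact: (measurableT_comp (measurable_tnth j) mf).
Qed.

Lemma set_coord0 n (x0 y : Rm) (xs : n.-tuple Rm) :
  set_coord ord0 (cons_pair (x0, xs)) y = cons_pair (y, xs).
Proof.
apply: eq_from_tnth => j; rewrite tnth_mktuple.
case: (unliftP ord0 j) => [k ->|->]; last by rewrite eqxx.
by rewrite eq_sym (negbTE (neq_lift _ _)) /cons_pair !tnthS.
Qed.

Lemma set_coord_lift n (i : 'I_n) (x0 y : Rm) (xs : n.-tuple Rm) :
  set_coord (lift ord0 i) (cons_pair (x0, xs)) y = cons_pair (x0, set_coord i xs y).
Proof.
apply: eq_from_tnth => j; rewrite tnth_mktuple.
case: (unliftP ord0 j) => [k ->|->]; last by rewrite (negbTE (neq_lift _ _)).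
by rewrite (inj_eq lift_inj) /cons_pair !tnthS tnth_mktuple.
Qed.

(** An independent copy of one coordinate leaves a product law unchanged; this is what allows nodes
    to be integrated out one by one. For the first coordinate, the old value integrates to 1 and the
    order of integration is exchanged. *)
Lemma integral_resample n (i : 'I_n) (F : n.-tuple Rm -> \bar R) :
  measurable_fun setT F -> (forall x, 0 <= F x) ->
  \int[power_sfm mu n]_x F x = \int[power_sfm mu n]_x \int[mu]_y F (set_coord i x y).
Proof.
elim: n i F => [[]//|n IH] i F mF F0.
have mF2 : measurable_fun setT (fun p => F (set_coord i p.1 p.2)).
  by apply: (measurableT_comp mF); exact: measurable_set_coord.
have mFi : measurable_fun setT (fun x => \int[mu]_y F (set_coord i x y)).
  exact: (measurable_fun_fubini_tonelli_F (fun p => F (set_coord i p.1 p.2))).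
have Fi0 x : 0 <= \int[mu]_y F (set_coord i x y) by exact: integral_ge0.
rewrite (integral_powerS _ mF F0) [RHS](integral_powerS _ mFi Fi0).
case: (unliftP ord0 i) => [k ->|->].
  apply: eq_integral => y _; rewrite (IH k)//; last exact: measurable_power_consr.
  apply: eq_integral => ys _; apply: eq_integral => z _.
  by rewrite set_coord_lift.
under [RHS]eq_integral => y _.
  under eq_integral => ys _ do under eq_integral => z _ do rewrite set_coord0.
  over.
rewrite [RHS]integral_cst// [X in _ * X](_ : _ = 1) ?mule1; last exact: probability_setT.
apply: (fubini_tonelli (F \o @cons_pair R n)) => [|p]; last exact: F0.
exact: (measurableT_comp mF (@measurable_cons_pair R n)).
Qed.

End resampling.

(** * The standard Gaussian field and the gluing map *)

Section gauss.
Local Open Scope ereal_scope.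
Variable R : realType.
Local Notation Rm := (measurableTypeR R).

Definition std_gauss : probability Rm R := normal_prob 0 1.
Local Notation gam := std_gauss.
Local Notation phi := (@normal_pdf R 0 1).

Lemma integral_std_gauss (f : Rm -> \bar R) :
  (forall x, 0 <= f x) -> measurable_fun setT f ->
  \int[gam]_x f x = \int[lebesgue_measure]_x (f x * (phi x)%:E).
Proof.
move=> f0 mf.
apply: (@ge0_integral_density _ _ _ (lebesgue_measure : {measure set Rm -> \bar R}) phi) => //.
  by move=> x; exact: normal_pdf_ge0.
exact: measurable_normal_pdf.
Qed.

Definition lebesgue_sf : {sigma_finite_measure set Rm -> \bar R} :=
  @lebesgue_measure R.

Definition std_gauss_pdf n (y : n.-tuple Rm) : R := (\prod_(i < n) phi (tnth y i))%R.

Lemma std_gauss_pdf_ge0 n (y : n.-tuple Rm) : (0 <= std_gauss_pdf y)%R.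
Proof. by apply: prodr_ge0 => i _; exact: normal_pdf_ge0. Qed.

Lemma measurable_std_gauss_pdf n : measurable_fun setT (@std_gauss_pdf n).
Proof.
rewrite /std_gauss_pdf; apply: measurable_prod => i _.
apply: measurableT_comp (measurable_normal_pdf _ _) _.
exact: measurable_tnth.
Qed.

(** The null law is a power of a Gaussian measure while [centered_gaussian] is a density relative to
    Lebesgue measure; this passes from one reference measure to the other. *)
Lemma integral_power_std_gauss n (F : n.-tuple Rm -> \bar R) :
  measurable_fun setT F -> (forall x, 0 <= F x) ->
  \int[power_sfm gam n]_x F x = \int[power_sfm lebesgue_sf n]_x (F x * (std_gauss_pdf x)%:E).
Proof.
elim: n F => [|n IH] F mF F0.
  rewrite !integral_power0//; first by rewrite /std_gauss_pdf big_ord0 mule1.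
  by apply: emeasurable_funM => //; apply/measurable_EFinP; exact: measurable_std_gauss_pdf.
rewrite integral_powerS// integral_std_gauss//; last 2 first.
- by move=> y; apply: integral_ge0.
- exact: measurable_power_inner.
rewrite [RHS]integral_powerS//; last 2 first.
- by apply: emeasurable_funM => //; apply/measurable_EFinP; exact: measurable_std_gauss_pdf.
- by move=> y; rewrite mule_ge0// lee_fin std_gauss_pdf_ge0.
apply: eq_integral => y _.
rewrite IH//; last exact: measurable_power_consr.
rewrite -ge0_integralZr//; last 3 first.
- apply: emeasurable_funM; first exact: measurable_power_consr.
  by apply/measurable_EFinP; exact: measurable_std_gauss_pdf.
- by move=> x _; rewrite mule_ge0// lee_fin std_gauss_pdf_ge0.
- by rewrite lee_fin normal_pdf_ge0.
apply: eq_integral => ys _.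
rewrite /std_gauss_pdf big_ord_recl -muleA -EFinM mulrC; congr (_ * (_ * _)%:E).
by apply: eq_bigr => i _; rewrite /cons_pair tnthS.
Qed.

End gauss.

(** * Invariance of a product law under gluing *)

Section glue.
Local Open Scope ereal_scope.
Variable R : realType.
Local Notation Rm := (measurableTypeR R).
Variables (mu : probability Rm R) (V : finType).

Lemma measurable_glue k (S : k.-tuple V) : measurable_fun setT (@glue R V k S).
Proof.
apply/measurable_fun_tnthP => i; have [iS|iS] := boolP (enum_val i \in S).
  have ik : (index (enum_val i) S < k)%N by move: iS; rewrite -index_mem size_tuple.
  rewrite (_ : _ \o _ = (@tnth k R)^~ (Ordinal ik) \o fst).
    exact: (measurableT_comp (measurable_tnth _) measurable_fst).
  by apply/funext => p; rewrite /= tnth_mktuple /= iS (tnth_nth 0%R).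
rewrite (_ : _ \o _ = (@tnth _ R)^~ i \o snd).
  exact: (measurableT_comp (measurable_tnth _) measurable_snd).
by apply/funext => p; rewrite /= tnth_mktuple /= (negbTE iS).
Qed.

Lemma glue0 (S : 0.-tuple V) y (z : config R V) : glue S (y, z) = z.
Proof. by apply: eq_from_tnth => i; rewrite tnth_mktuple tuple0. Qed.

Lemma glueS k (s : V) (S : k.-tuple V) y0 ys (z : config R V) :
  glue [tuple of s :: S] (cons_pair (y0, ys), z) =
  set_coord (enum_rank s) (glue S (ys, z)) y0.
Proof.
apply: eq_from_tnth => i; rewrite tnth_mktuple [RHS]tnth_mktuple tnth_mktuple /= in_cons.
have -> : (i == enum_rank s) = (s == enum_val i).
  by rewrite -(inj_eq enum_val_inj) enum_rankK eq_sym.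
by rewrite [enum_val i == s]eq_sym; case: eqP.
Qed.

(** By [glueS], gluing along [s :: S] is gluing along [S] followed by overwriting the coordinate
    [s], so each induction step is one use of [integral_resample]. *)
Lemma integral_glue k (S : k.-tuple V) (F : config R V -> \bar R) :
  measurable_fun setT F -> (forall x, 0 <= F x) ->
  \int[power_sfm mu k]_y \int[power_sfm mu #|V|]_z F (glue S (y, z)) = \int[power_sfm mu #|V|]_x F x.
Proof.
elim: k S F => [|k IH] S F mF F0.
  rewrite integral_power0; first by apply: eq_integral => z _; rewrite glue0.
  apply: (measurable_fun_fubini_tonelli_F (F \o glue S)) => [|p]; last exact: F0.
  exact: measurableT_comp mF (measurable_glue S).
have mFg : measurable_fun setT (F \o glue S) by exact: measurableT_comp mF (measurable_glue S).
rewrite integral_powerS//; last 2 first.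
- apply: (measurable_fun_fubini_tonelli_F (F \o glue S)) => // p; exact: F0.
- by move=> x; apply: integral_ge0.
case/tupleP: S mFg => s S _.
have mF2 : measurable_fun setT (fun p => F (set_coord (enum_rank s) p.2 p.1)).
  by apply: (measurableT_comp mF); exact: measurable_set_coord.
rewrite [RHS](integral_resample mu (enum_rank s))//.
rewrite -[RHS](fubini_tonelli (fun p => F (set_coord (enum_rank s) p.2 p.1)))//.
apply: eq_integral => y _.
rewrite /fubini_F/= -(IH S (fun x => F (set_coord (enum_rank s) x y))); last 2 first.
- by apply: (measurableT_comp mF); exact: measurable_set_coord.
- by move=> x; exact: F0.
- apply: eq_integral => ys _; apply: eq_integral => z _.
  by rewrite glueS.
Qed.

End glue.

(** * The autoregressive kernel *)

Section kernel.
Variable R : realType.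
Local Notation Rm := (measurableTypeR R).
Local Notation gam := (@std_gauss R).

Lemma measurable_expR_quad (a b c : R) :
  measurable_fun setT (fun y : Rm => expR (a * y ^+ 2 + b * y + c)).
Proof.
apply: (measurableT_comp (@measurable_expR R)).
apply: measurable_funD => //; apply: measurable_funD; apply: measurable_funM => //.
Qed.

(** Completion of the square. The quadratic coefficient is written so that, together with the
    Gaussian weight, it becomes [- A / 2]. *)
Lemma integral_gauss_quad (A b c : R) : 0 < A ->
  (\int[gam]_y (expR (- (A - 1) / 2 * y ^+ 2 + b * y + c))%:E
   = ((Num.sqrt A)^-1 * expR (b ^+ 2 / (2 * A) + c))%:E)%E.
Proof.
move=> A0; rewrite integral_std_gauss; last 2 first.
- by move=> y; rewrite lee_fin expR_ge0.
- by apply/measurable_EFinP; exact: measurable_expR_quad.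
pose s := (Num.sqrt A)^-1; have s0 : s != 0 by rewrite invr_eq0 gt_eqF ?sqrtr_gt0.
have s2 : s ^+ 2 = A^-1 by rewrite exprVn sqr_sqrtr ?ltW.
pose K := s * expR (b ^+ 2 / (2 * A) + c).
have E y : expR (- (A - 1) / 2 * y ^+ 2 + b * y + c) * normal_pdf 0 1 y =
    K * normal_pdf (b / A) s y.
  rewrite !normal_pdfE ?oner_eq0// /normal_peak /normal_fun /K s2 expr1n mul1r.
  rewrite -[_ * pi *+ 2]mulrnAr.
  rewrite sqrtrM ?invr_ge0 ?ltW// sqrtrV ?ltW// [((Num.sqrt A)^-1 * _)^-1]invfM invrK.
  rewrite mulrCA -expRD -/s.
  rewrite [RHS]mulrACA [s * _]mulrA /s mulVf ?gt_eqF ?sqrtr_gt0// mul1r.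
  congr (_ * _); rewrite -expRD; congr expR.
  by field; rewrite gt_eqF.
under eq_integral do rewrite -EFinM E EFinM.
rewrite ge0_integralZl//.
- by rewrite integral_normal_pdf mule1.
- by apply/measurable_EFinP; exact: measurable_normal_pdf.
- by move=> y _; rewrite lee_fin normal_pdf_ge0.
- by rewrite lee_fin mulr_ge0 ?expR_ge0// invr_ge0.
Qed.

(* The transition density of the AR(1) chain with respect to its stationary
   law N(0, 1) (Mehler kernel). *)
Definition ar1_kernel (r x y : R) : R :=
  (Num.sqrt (1 - r ^+ 2))^-1 *
  expR (- (r ^+ 2 * x ^+ 2 - 2 * r * x * y + r ^+ 2 * y ^+ 2) / (2 * (1 - r ^+ 2))).
Local Notation q := ar1_kernel.

Lemma ar1_kernel_ge0 r x y : 0 <= q r x y.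
Proof. by rewrite mulr_ge0 ?expR_ge0// invr_ge0. Qed.

Lemma ar1_kernelC r x y : q r x y = q r y x.
Proof.
rewrite /ar1_kernel (_ : r ^+ 2 * x ^+ 2 - _ + _ =
  r ^+ 2 * y ^+ 2 - 2 * r * y * x + r ^+ 2 * x ^+ 2)//.
by ring.
Qed.

Lemma ar1_kernel0 x y : q 0 x y = 1.
Proof. by rewrite /ar1_kernel expr0n/= subr0 sqrtr1 invr1 !mul0r mulr0 !mul0r subr0 addr0 oppr0 mul0r expR0 mulr1. Qed.

Lemma measurable_ar1_kernel r d (T : measurableType d) (f g : T -> Rm) :
  measurable_fun setT f -> measurable_fun setT g ->
  measurable_fun setT (fun t => q r (f t) (g t)).
Proof.
move=> mf mg; apply: measurable_funM => //.
apply: (measurableT_comp (@measurable_expR R)).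
apply: measurable_funM => //; apply: measurableT_comp => //.
apply: measurable_funD; first apply: measurable_funB.
- by apply: measurable_funM => //; exact: measurable_funX.
- by apply: measurable_funM => //; apply: measurable_funM => //.
- by apply: measurable_funM => //; exact: measurable_funX.
Qed.

Section bounds.
Implicit Types r s x y z : R.

Lemma sub1sqr_gt0 r : `|r| < 1 -> 0 < 1 - r ^+ 2.
Proof. by move=> r1; rewrite subr_gt0 -real_normK ?num_real// expr_lt1. Qed.

(** The semigroup property of the Mehler kernels: two AR(1) transitions with coefficients [r] and
    [s] compose to one with coefficient [r * s]. The product of kernels is the exponential of a
    quadratic in [y]. *)
Lemma integral_ar1_kernel_comp r s x z : `|r| < 1 -> `|s| < 1 ->
  (\int[gam]_y (q r x y * q s y z)%:E = (q (r * s) x z)%:E)%E.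
Proof.
move=> /sub1sqr_gt0 r1 /sub1sqr_gt0 s1.
pose A := (1 - r ^+ 2 * s ^+ 2) / ((1 - r ^+ 2) * (1 - s ^+ 2)).
have rs1 : 0 < 1 - r ^+ 2 * s ^+ 2.
  have := sqr_ge0 r; have := sqr_ge0 s; nra.
have A0 : 0 < A by rewrite divr_gt0// mulr_gt0.
pose b := r * x / (1 - r ^+ 2) + s * z / (1 - s ^+ 2).
pose c := - (r ^+ 2 * x ^+ 2) / (2 * (1 - r ^+ 2)) - (s ^+ 2 * z ^+ 2) / (2 * (1 - s ^+ 2)).
pose K := (Num.sqrt (1 - r ^+ 2))^-1 * (Num.sqrt (1 - s ^+ 2))^-1.
have E y : q r x y * q s y z = K * expR (- (A - 1) / 2 * y ^+ 2 + b * y + c).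
  rewrite /ar1_kernel mulrACA -/K -expRD; congr (K * expR _).
  by rewrite /A /b /c; field; rewrite !gt_eqF.
under eq_integral do rewrite E EFinM.
rewrite ge0_integralZl//.
- rewrite integral_gauss_quad// -EFinM; congr EFin.
  rewrite mulrA /ar1_kernel [(r * s) ^+ 2]exprMn; congr (_ * expR _).
    rewrite /K /A sqrtrM ?(ltW rs1)// sqrtrV ?mulr_ge0 ?ltW// sqrtrM ?ltW//.
    by field; rewrite !gt_eqF ?sqrtr_gt0.
  by rewrite /A /b /c; field; rewrite exprMn !gt_eqF.
- by apply/measurable_EFinP; exact: measurable_expR_quad.
- by rewrite lee_fin mulr_ge0// invr_ge0.
Qed.

Lemma integral_ar1_kernel r x : `|r| < 1 ->
  (\int[gam]_y (q r x y)%:E = 1)%E.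
Proof.
move=> r1; have := @integral_ar1_kernel_comp r 0 x 0 r1.
rewrite normr0 ltr01 mulr0 ar1_kernel0 => <- //.
by apply: eq_integral => y _; rewrite ar1_kernel0 mulr1.
Qed.

(** The squared kernel integrates to a function growing like a Gaussian exponential in [w]. For
    small [r] this growth stays below the weight [expR (a / 8 * w ^+ 2)], so a weight at [y] is
    traded for the same weight at [w] at the cost [1 + a]. *)
Lemma integral_sqr_ar1_kernel (a r w : R) : 0 < a <= 1 -> r ^+ 2 <= a / 32 ->
  (\int[gam]_y (q r y w ^+ 2 * expR (a / 8 * y ^+ 2))%:E
   <= ((1 + a) * expR (a / 8 * w ^+ 2))%:E)%E.
Proof.
move=> /andP[a0 a1] r2; have rr := sqr_ge0 r.
have r0 : 0 < 1 - r ^+ 2 by lra.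
pose B : R := a / 8.
have B1 : 0 < 1 - 2 * B by rewrite /B; lra.
pose A := 1 - 2 * B + 2 * r ^+ 2 / (1 - r ^+ 2).
pose b := 2 * r * w / (1 - r ^+ 2).
pose c := - (r ^+ 2 * w ^+ 2) / (1 - r ^+ 2).
have A1 : 1 - 2 * B <= A.
  rewrite /A lerDl; apply: divr_ge0; first by rewrite mulr_ge0.
  exact: ltW.
have A0 : 0 < A by apply: lt_le_trans A1.
have E y : q r y w ^+ 2 * expR (B * y ^+ 2) =
    (1 - r ^+ 2)^-1 * expR (- (A - 1) / 2 * y ^+ 2 + b * y + c).
  rewrite /ar1_kernel exprMn exprVn sqr_sqrtr ?ltW// -expRM_natl -[LHS]mulrA -expRD.
  congr (_ * expR _).
  by rewrite /A /b /c; field; rewrite gt_eqF.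
under eq_integral do rewrite E EFinM.
rewrite ge0_integralZl//; last 2 first.
- by apply/measurable_EFinP; exact: measurable_expR_quad.
- by rewrite lee_fin invr_ge0 ltW.
rewrite integral_gauss_quad// -EFinM lee_fin mulrA.
apply: ler_pM.
- by rewrite mulr_ge0 ?invr_ge0 ?sqrtr_ge0 ?ltW.
- exact: expR_ge0.
(* Here [1 - 2 * B] lies in (0, 1], hence is at most its own square root. *)
- have sA : 1 - 2 * B <= Num.sqrt A.
    rewrite -(ler_pXn2r (ltn0Sn 1)) ?nnegrE ?sqrtr_ge0 ?(ltW B1)// sqr_sqrtr ?(ltW A0)//.
    apply: le_trans A1; rewrite expr2 ger_pMl//; rewrite /B; lra.
  have sA0 : 0 < Num.sqrt A by rewrite sqrtr_gt0.
  rewrite -invfM -[leRHS]invrK lef_pV2 ?posrE ?mulr_gt0// ?invr_gt0; last by lra.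
  apply: (@le_trans _ _ ((1 - a / 8) * (1 - 2 * B))).
    rewrite -div1r ler_pdivrMr; last by lra.
    rewrite /B; nra.
  by apply: ler_pM => //; rewrite /B; lra.
- rewrite ler_expR; apply: (@le_trans _ _ (b ^+ 2 / (2 * A))).
    rewrite gerDl /c mulNr oppr_le0; apply: divr_ge0; first by rewrite mulr_ge0 ?sqr_ge0.
    exact: ltW.
  rewrite ler_pdivrMr ?mulr_gt0// /b !exprMn exprVn ler_pdivrMr ?exprn_gt0//.
  have w2 := sqr_ge0 w.
  (* The left side is at most [a / 8] by the hypothesis on [r], and on the right [2 * A] is at least
     3/2 and the last square at least 3/4, with product 9/8. *)
  have h1 : 2 ^+ 2 * r ^+ 2 <= a / 8 * (2 * A) * (1 - r ^+ 2) ^+ 2.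
    apply: (@le_trans _ _ (a / 8 * (2 * (1 - 2 * B)) * (1 - a / 32) ^+ 2)).
      have h3 : (3 / 4 : R) <= (1 - a / 32) ^+ 2 by nra.
      have h4 : (3 / 2 : R) <= 2 * (1 - 2 * B) by rewrite /B; lra.
      apply: (@le_trans _ _ (a / 8 * (3 / 2) * (3 / 4))); first by lra.
      apply: ler_pM => //; try lra.
      by apply: ler_wpM2l => //; lra.
    apply: ler_pM; rewrite ?sqr_ge0//.
    - by rewrite mulr_ge0// ?mulr_ge0 ?(ltW B1)//; lra.
    - by apply: ler_wpM2l; [lra|rewrite ler_pM2l].
    - by apply: lerXn2r; rewrite ?nnegrE; lra.
  rewrite [leLHS](_ : _ = (2 ^+ 2 * r ^+ 2) * w ^+ 2); last by ring.
  rewrite [leRHS](_ : _ = (a / 8 * (2 * A) * (1 - r ^+ 2) ^+ 2) * w ^+ 2); last by ring.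
  exact: ler_wpM2r.
Qed.

Lemma integral_expR_sqr (a : R) : 0 < a <= 1 ->
  (\int[gam]_y (expR (a / 8 * y ^+ 2))%:E <= (1 + a)%:E)%E.
Proof.
move=> ha; have /andP[a0 _] := ha.
have := @integral_sqr_ar1_kernel a 0 0 ha; rewrite expr0n/= mulr0 expR0 mulr1.
by under eq_integral do rewrite ar1_kernel0 expr1n mul1r; apply; lra.
Qed.

(** The Hellinger affinity of a transition with the stationary law. After integration the exponent
    in [x] is nonpositive, so the bound is uniform in [x]; it vanishes as [|r|] tends to 1. *)
Lemma integral_sqrt_ar1_kernel r x : `|r| < 1 ->
  (\int[gam]_y (Num.sqrt (q r x y))%:E
   <= (Num.sqrt 2 * Num.sqrt (Num.sqrt (1 - r ^+ 2)))%:E)%E.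
Proof.
move=> /sub1sqr_gt0 r1; have rr := sqr_ge0 r.
pose A := (2 - r ^+ 2) / (2 * (1 - r ^+ 2)).
have A0 : 0 < A by rewrite divr_gt0 ?mulr_gt0//; lra.
pose b := r * x / (2 * (1 - r ^+ 2)).
pose c := - (r ^+ 2 * x ^+ 2) / (4 * (1 - r ^+ 2)).
pose s := Num.sqrt (1 - r ^+ 2).
have s0 : 0 < s by rewrite sqrtr_gt0.
have ss0 : 0 < Num.sqrt s by rewrite sqrtr_gt0.
have E y : Num.sqrt (q r x y) =
    (Num.sqrt s)^-1 * expR (- (A - 1) / 2 * y ^+ 2 + b * y + c).
  rewrite /ar1_kernel -/s sqrtrM ?invr_ge0 ?ltW// sqrtrV ?ltW//; congr (_ * _).
  have h u : Num.sqrt (expR u) = expR (u / 2) :> R.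
    rewrite [in LHS](splitr u) expRD -expr2 sqrtr_sqr ger0_norm ?expR_ge0//.
  rewrite h -?expRD; congr expR.
  by rewrite /A /b /c; field; rewrite gt_eqF.
under eq_integral do rewrite E EFinM.
rewrite ge0_integralZl//; last by apply/measurable_EFinP; exact: measurable_expR_quad.
rewrite integral_gauss_quad// -EFinM lee_fin mulrA -[leRHS]mulr1.
have s2 : s = Num.sqrt s ^+ 2 by rewrite sqr_sqrtr ?ltW.
apply: ler_pM; rewrite ?expR_ge0 ?mulr_ge0 ?invr_ge0 ?sqrtr_ge0//.
- have -> : (Num.sqrt s)^-1 * (Num.sqrt A)^-1 <= Num.sqrt 2 * Num.sqrt s =
      ((Num.sqrt A)^-1 <= Num.sqrt 2 * s).
    by rewrite ler_pdivrMl// mulrCA -expr2 -s2.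
  rewrite -sqrtrV ?(ltW A0)// [X in _ <= _ * X](_ : s = Num.sqrt (s ^+ 2)); last first.
    by rewrite sqrtr_sqr gtr0_norm.
  rewrite -sqrtrM// ler_wsqrtr// /s sqr_sqrtr ?ltW// /A invf_div.
  by rewrite ltr_pdivrMr; nra.
- rewrite -[leRHS]expR0 ler_expR.
  have -> : b ^+ 2 / (2 * A) + c =
      - (r ^+ 2 * x ^+ 2) / (4 * (2 - r ^+ 2)).
    by rewrite /A /b /c; field; rewrite !gt_eqF//; lra.
  have r3 : 0 < 2 - r ^+ 2 by lra.
  rewrite mulNr oppr_le0; apply: divr_ge0; first by rewrite mulr_ge0 ?sqr_ge0.
  by rewrite mulr_ge0// ltW.
Qed.

End bounds.
End kernel.

(** * Likelihood of a path *)

Section ar1_matrix.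
Variables (R : realType) (psi : R) (k : nat).
Local Notation q := (ar1_kernel psi).

(** The predecessor of 0 is 0 by convention, hence the guards [0 < i] below. *)
Definition ord_prev (i : 'I_k) : 'I_k :=
  Ordinal (leq_ltn_trans (leq_pred i) (ltn_ord i)).

Definition shift_mx : 'M[R]_k :=
  \matrix_(i, j) ((0 < i)%N && (j == ord_prev i))%:R.

(* innov_mx maps the process to its innovations x_i - psi x_(i-1); its inverse
   ar1_mx gives the decomposition ar1_cov = ar1_mx D ar1_mx^T. *)
Definition innov_mx : 'M[R]_k := 1%:M - psi *: shift_mx.

Definition ar1_mx : 'M[R]_k :=
  \matrix_(i, j) (if (j <= i)%N then psi ^+ (i - j) else 0).

(** The first innovation is the stationary variable itself, of variance 1. *)
Definition innov_var (i : nat) : R := if i is 0 then 1 else 1 - psi ^+ 2.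

Lemma mul_innov_mx p (X : 'M[R]_(k, p)) i j :
  (innov_mx *m X) i j = X i j - (if (0 < i)%N then psi * X (ord_prev i) j else 0).
Proof.
rewrite mulmxBl mul1mx -scalemxAl !mxE; congr (_ - _).
rewrite (bigD1 (ord_prev i))//= big1 ?addr0; last first.
  by move=> l /negbTE il; rewrite mxE il andbF mul0r.
by rewrite mxE eqxx andbT; case: ltnP => _; rewrite ?mul1r// mul0r mulr0.
Qed.

Lemma innov_ar1_mx : innov_mx *m ar1_mx = 1%:M.
Proof.
apply/matrixP => i j; rewrite mul_innov_mx !mxE -(inj_eq val_inj)/=.
case: i j => [[|i] /= hi] [j /= hj]; first by case: j hj => [|j] hj; rewrite subr0.
rewrite [_ == j]eq_sym; case: (ltngtP j i.+1) => [|ij|->]; rewrite ?ltnS.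
- by move=> ij; rewrite ij subSn// exprS subrr.
- by rewrite leqNgt (ltn_trans (ltnSn _) ij) mulr0 subr0.
- by rewrite ltnn mulr0 subr0 subnn.
Qed.

(** For positive [i], the difference of [psi ^+ |i - j|] and [psi * psi ^+ |i - 1 - j|] cancels when
    [j < i] and equals [(1 - psi ^+ 2) * psi ^+ (j - i)] otherwise: an innovation is uncorrelated
    with the past. *)
Lemma innov_ar1_cov i j : (innov_mx *m ar1_cov psi k) i j = innov_var i * ar1_mx j i.
Proof.
rewrite mul_innov_mx !mxE /=.
case: i j => [[|i] /= hi] [j /= hj]; first by rewrite subr0 mul1r distnC subn0 distn0.
case: (leqP i.+1 j) => ij.
  rewrite !distnEr ?(ltnW ij)// -(subnSK ij).
  by rewrite mulrBl mul1r -exprS -exprD add2n.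
by rewrite mulr0 !distnEl ?(ltnW ij)// subSn// exprS subrr.
Qed.

Definition innov_var_row : 'rV[R]_k := \row_i innov_var i.

Lemma ar1_covE : innov_mx *m ar1_cov psi k = diag_mx innov_var_row *m ar1_mx^T.
Proof. by apply/matrixP => i j; rewrite innov_ar1_cov mul_diag_mx !mxE. Qed.

Lemma det_ar1_mx : \det ar1_mx = 1.
Proof.
rewrite det_trig; first by rewrite big1// => i _; rewrite mxE leqnn subnn.
by apply/is_trig_mxP => i j ij; rewrite mxE leqNgt ij.
Qed.

Lemma det_ar1_cov : \det (ar1_cov psi k) = \prod_(i < k) innov_var i.
Proof.
have M1 : \det innov_mx = 1.
  by have := congr1 determinant innov_ar1_mx; rewrite det_mulmx det_ar1_mx mulr1 det1.
have := congr1 determinant ar1_covE; rewrite !det_mulmx det_tr det_ar1_mx M1.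
by rewrite mul1r mulr1 det_diag => ->; apply: eq_bigr => i _; rewrite mxE.
Qed.

Hypothesis psi1 : `|psi| < 1.

Lemma innov_var_gt0 i : 0 < innov_var i.
Proof. by case: i => //= _; exact: sub1sqr_gt0. Qed.

(** With M = [innov_mx], N = [ar1_mx] its inverse and D the innovation variances, [ar1_covE] says
    that the covariance is N D N^T, whose inverse is M^T D^-1 M. *)
Lemma invmx_ar1_cov : invmx (ar1_cov psi k) =
  innov_mx^T *m diag_mx (\row_i (innov_var i)^-1) *m innov_mx.
Proof.
have cov1 : ar1_cov psi k *m (innov_mx^T *m diag_mx (\row_i (innov_var i)^-1) *m innov_mx) = 1%:M.
  have <- : ar1_mx *m (diag_mx innov_var_row *m ar1_mx^T) = ar1_cov psi k.
    by rewrite -ar1_covE mulmxA (mulmx1C innov_ar1_mx) mul1mx.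
  rewrite !mulmxA -[X in X *m _ *m _]mulmxA -trmx_mul innov_ar1_mx trmx1 mulmx1.
  rewrite -[X in X *m _]mulmxA mulmx_diag.
  rewrite (_ : diag_mx _ = 1%:M) ?mulmx1 ?(mulmx1C innov_ar1_mx)//.
  apply/matrixP => i j; rewrite !mxE; case: eqP => // ->.
  by rewrite divff// gt_eqF// innov_var_gt0.
have [u _] := mulmx1_unit cov1.
by rewrite -[LHS]mulmx1 -cov1 mulKmx.
Qed.

Lemma quad_ar1_cov (u : 'rV[R]_k) : (u *m invmx (ar1_cov psi k) *m u^T) 0 0 =
  \sum_i (u 0 i - (if (0 < i)%N then psi * u 0 (ord_prev i) else 0)) ^+ 2 / innov_var i.
Proof.
pose w := innov_mx *m u^T.
have -> : u *m invmx (ar1_cov psi k) *m u^T =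
    w^T *m diag_mx (\row_i (innov_var i)^-1) *m w.
  by rewrite invmx_ar1_cov /w trmx_mul trmxK !mulmxA.
have wi i : w i 0 = u 0 i - (if (0 < i)%N then psi * u 0 (ord_prev i) else 0).
  by rewrite /w mul_innov_mx !mxE.
clearbody w; rewrite mul_mx_diag mxE; apply: eq_bigr => i _.
by rewrite !mxE wi mulrAC -expr2.
Qed.

End ar1_matrix.

Section likelihood.
Local Open Scope ring_scope.
Variables (R : realType) (psi : R).
Local Notation q := (ar1_kernel psi).
Local Notation Rm := (measurableTypeR R).

(** The likelihood ratio of the AR(1) law against white noise, as [gaussian_pdf_ar1] shows. *)
Fixpoint chain_density (s : seq R) : R :=
  if s is x :: s' then
    (if s' is y :: _ then q x y else 1) * chain_density s'
  else 1.

Lemma chain_density_ge0 s : 0 <= chain_density s.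
Proof.
by elim: s => //= x [|y s] IH; apply: mulr_ge0 => //; exact: ar1_kernel_ge0.
Qed.

Lemma chain_densityE s : chain_density s =
  \prod_(i < size s) (if (0 < i)%N then q (nth 0 s i.-1) (nth 0 s i) else 1).
Proof.
elim: s => [|x s IH]; first by rewrite big_ord0.
rewrite [LHS]/= big_ord_recl mul1r.
case: s IH => [|y s] IH; first by rewrite big_ord0 mulr1.
rewrite big_ord_recl; congr (_ * _); rewrite IH big_ord_recl mul1r.
by apply: eq_bigr => i _.
Qed.

Lemma sqrtr_prod (I : Type) (r : seq I) (P : pred I) (F : I -> R) :
  (forall i, 0 <= F i) ->
  Num.sqrt (\prod_(i <- r | P i) F i) = \prod_(i <- r | P i) Num.sqrt (F i).
Proof.
move=> F0; elim: r => [|i r IH]; first by rewrite !big_nil sqrtr1.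
by rewrite !big_cons; case: (P i) => //; rewrite sqrtrM// IH.
Qed.

(** Both sides factor over the indices. The factor at a positive [i] is the density of N(psi
    y_(i-1), 1 - psi^2) at y_i, which is a Mehler kernel times the standard normal density. *)
Lemma gaussian_pdf_ar1 k (y : k.-tuple Rm) : `|psi| < 1 ->
  centered_gaussian_pdf (ar1_cov psi k) y = chain_density y * std_gauss_pdf y.
Proof.
move=> psi1.
rewrite /centered_gaussian_pdf quad_ar1_cov// det_ar1_cov.
rewrite chain_densityE size_tuple /std_gauss_pdf -big_split/=.
have -> : (2 * pi) ^+ k = \prod_(i < k) (2 * pi) :> R by rewrite prodr_const card_ord.
rewrite -big_split/= sqrtr_prod; last first.
  by move=> i; rewrite mulr_ge0 ?(ltW (innov_var_gt0 _ _))// mulr_ge0// pi_ge0.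
rewrite -sumrN mulr_suml expR_sum -prodfV -big_split/=.
apply: eq_bigr => i _.
rewrite normal_pdfE ?oner_eq0// /normal_peak /normal_fun expr1n mul1r subr0 !mxE.
rewrite !(tnth_nth 0)/=.
have -> : 2 * pi = pi *+ 2 :> R by rewrite mulr_natl.
case: i => [[|i] /= hi]; first by rewrite mulr1 subr0 divr1 mul1r.
have r1 := sub1sqr_gt0 psi1.
have pi2 : 0 <= pi *+ 2 :> R := mulrn_wge0 2 (pi_ge0 R).
rewrite sqrtrM// invfM mulrC /ar1_kernel.
rewrite [RHS]mulrACA [_^-1 * (Num.sqrt (pi *+ 2))^-1]mulrC -expRD [LHS]mulrC; congr (_ * expR _).
by field; rewrite gt_eqF.
Qed.

Variable V : finType.
Implicit Types (x : config R V) (S : seq V).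

Definition field x (v : V) : Rm := tnth x (enum_rank v).

Lemma measurable_field v : measurable_fun setT (field ^~ v).
Proof. exact: measurable_tnth. Qed.

Definition path_density S x : R := chain_density (map (field x) S).

Lemma path_density_ge0 S x : 0 <= path_density S x.
Proof. exact: chain_density_ge0. Qed.

Lemma measurable_chain_density (I : Type) d (T : measurableType d)
    (s : seq I) (f : I -> T -> Rm) :
  (forall i, measurable_fun setT (f i)) ->
  measurable_fun setT (fun t => chain_density (map (f ^~ t) s)).
Proof.
move=> mf; elim: s => [|i [|j s] IH] /=; [exact: measurable_cst|exact: measurable_cst|].
apply: measurable_funM => //; exact: measurable_ar1_kernel.
Qed.

Lemma measurable_path_density S : measurable_fun setT (path_density S).
Proof. exact: (measurable_chain_density S measurable_field). Qed.

Lemma field_glue k (S : k.-tuple V) (y : k.-tuple Rm) (z : config R V) :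
  uniq S -> map (field (glue S (y, z))) S = y.
Proof.
move=> uS; apply: (@eq_from_nth _ 0); rewrite size_map !size_tuple// => i ik.
case: k S y uS ik => // k S y uS ik.
have v0 : V by exact: (thead S).
rewrite (nth_map v0) ?size_tuple// /field tnth_mktuple /= enum_rankK.
by rewrite mem_nth ?size_tuple// index_uniq// size_tuple.
Qed.

(** The AR(1) vector on [S] is replaced by white noise weighted by [chain_density]; [integral_glue]
    then merges the two independent white noises into the null law. *)
Lemma path_lawE k (S : k.-tuple V) (A : set (config R V)) : `|psi| < 1 ->
  uniq S -> measurable A ->
  (path_law psi S A =
   \int[power_sfm (@std_gauss R) #|V|]_x ((\1_A x * path_density S x)%:E))%E.
Proof.
move=> psi1 uS mA.
have mF : measurable_fun setT (fun x => (\1_A x * path_density S x)%:E).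
  apply/measurable_EFinP; apply: measurable_funM; last exact: measurable_path_density.
  exact: measurable_indic.
rewrite -(integral_glue _ S)//; last first.
  by move=> x; rewrite lee_fin mulr_ge0// path_density_ge0.
have nullE : @null_law R V = power_sfm (@std_gauss R) #|V| by exact: power_measureE.
have pdfE : @centered_gaussian_pdf R k (ar1_cov psi k) =
    (fun y => chain_density y * std_gauss_pdf y).
  by apply/funext => y; exact: gaussian_pdf_ar1.
have cgE : @centered_gaussian R k (ar1_cov psi k) =
    density (power_sfm (lebesgue_sf R) k) (fun y => chain_density y * std_gauss_pdf y).
  by rewrite /centered_gaussian pdfE power_measureE.
have mchain : measurable_fun setT (fun y : k.-tuple Rm => chain_density y).
  rewrite (_ : (fun y : k.-tuple Rm => _) =
    fun y => chain_density (map (fun i => tnth y i) (enum 'I_k))).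
    by apply: measurable_chain_density => i; exact: measurable_tnth.
  by apply/funext => y; rewrite map_tnth_enum.
have mB : measurable (glue S @^-1` A).
  by rewrite -[X in measurable X]setTI; exact: measurable_glue.
rewrite /path_law /pushforward /product_measure1 nullE cgE.
have mh := measurable_fun_xsection (power_sfm (@std_gauss R) #|V|) mB.
rewrite ge0_integral_density//; last 2 first.
- by move=> y; rewrite mulr_ge0 ?chain_density_ge0 ?std_gauss_pdf_ge0.
- by apply: measurable_funM => //; exact: measurable_std_gauss_pdf.
under eq_integral do rewrite EFinM muleA.
rewrite -integral_power_std_gauss; last 2 first.
- by apply: emeasurable_funM => //; exact/measurable_EFinP.
- by move=> y; rewrite mule_ge0// lee_fin chain_density_ge0.
apply: eq_integral => y _ /=.
under [RHS]eq_integral do rewrite /path_density field_glue// EFinM.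
rewrite ge0_integralZr//; last 2 first.
- apply/measurable_EFinP.
  rewrite (_ : (fun z => _) = \1_(xsection (glue S @^-1` A) y)).
    by apply: measurable_indic; exact: measurable_xsection.
  by apply/funext => z; rewrite !indicE mem_xsection.
- by rewrite lee_fin chain_density_ge0.
congr (_ * _)%E.
transitivity (\int[power_sfm (@std_gauss R) #|V|]_z
    ((\1_(xsection (glue S @^-1` A) y) z)%:E))%E.
  by rewrite integral_indic ?setIT//; exact: measurable_xsection.
by apply: eq_integral => z _; rewrite !indicE mem_xsection.
Qed.

End likelihood.

(** * Moments of the likelihood *)

Section integrate_out.
Variables (R : realType) (V : finType).
Local Notation Rm := (measurableTypeR R).
Local Notation gam := (@std_gauss R).
Local Notation P0 := (power_sfm gam #|V|).

Definition set_field (v : V) (x : config R V) (y : Rm) : config R V :=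
  set_coord (enum_rank v) x y.

Lemma field_set_field v x y w :
  field (set_field v x y) w = if w == v then y else field x w.
Proof. by rewrite /field tnth_mktuple (inj_eq enum_rank_inj). Qed.

Lemma field_set_field_id v x y : field (set_field v x y) v = y.
Proof. by rewrite field_set_field eqxx. Qed.

Lemma path_density_set_field psi (S : seq V) v x y : v \notin S ->
  path_density psi S (set_field v x y) = path_density psi S x.
Proof.
move=> vS; congr chain_density; apply/eq_in_map => w wS.
by rewrite field_set_field; case: eqP => // wv; rewrite -wv wS in vS.
Qed.

Lemma measurable_set_field v (H : config R V -> R) : measurable_fun setT H ->
  measurable_fun setT (fun p : config R V * Rm => H (set_field v p.1 p.2)).
Proof. by move=> mH; apply: (measurableT_comp mH); exact: measurable_set_coord. Qed.

Variables (v : V) (G H : config R V -> R).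
Hypotheses (mG : measurable_fun setT G) (mH : measurable_fun setT H).
Hypotheses (G0 : forall x, 0 <= G x) (H0 : forall x, 0 <= H x).
Hypothesis Gv : forall x y, G (set_field v x y) = G x.

(** Resampling the value at [v] leaves [G] fixed, so only [H] is averaged. The two variants below
    replace that average by its value or by an upper bound. *)
Lemma integrate_out :
  (\int[P0]_x (G x * H x)%:E =
   \int[P0]_x ((G x)%:E * \int[gam]_y (H (set_field v x y))%:E))%E.
Proof.
have mGH : measurable_fun setT (fun x => (G x * H x)%:E).
  by apply/measurable_EFinP; exact: measurable_funM.
rewrite (integral_resample gam (enum_rank v) mGH); last first.
  by move=> x; rewrite lee_fin mulr_ge0.
apply: eq_integral => x _; rewrite -ge0_integralZl//; last 3 first.
- apply/measurable_EFinP; apply: (measurableT_comp mH).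
  by apply: (measurable_set_coord _ (f := cst x) (g := id)).
- by move=> y _; rewrite lee_fin.
- by rewrite lee_fin.
by apply: eq_integral => y _; rewrite Gv.
Qed.

Lemma integrate_out_eq (K : config R V -> R) :
  (forall x, (\int[gam]_y (H (set_field v x y))%:E = (K x)%:E)%E) ->
  (\int[P0]_x (G x * H x)%:E = \int[P0]_x (G x * K x)%:E)%E.
Proof.
move=> HK; rewrite integrate_out; apply: eq_integral => x _.
by rewrite HK EFinM.
Qed.

Lemma integrate_out_le (K : config R V -> R) : measurable_fun setT K ->
  (forall x, (\int[gam]_y (H (set_field v x y))%:E <= (K x)%:E)%E) ->
  (\int[P0]_x (G x * H x)%:E <= \int[P0]_x (G x * K x)%:E)%E.
Proof.
move=> mK HK; rewrite integrate_out; apply: ge0_le_integral => //.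
- move=> x _; apply: mule_ge0; rewrite ?lee_fin//; apply: integral_ge0 => y _.
  by rewrite lee_fin.
- apply: emeasurable_funM; first exact/measurable_EFinP.
  apply: (measurable_fun_fubini_tonelli_F
    (fun p : config R V * Rm => (H (set_field v p.1 p.2))%:E)) => [|p].
    by apply/measurable_EFinP; exact: measurable_set_field.
  by rewrite lee_fin.
- by apply/measurable_EFinP; exact: measurable_funM.
- by move=> x _; rewrite EFinM lee_wpmul2l ?lee_fin.
Qed.

End integrate_out.

(** * First, half and cross moments of path likelihoods *)

Section moments.
Variables (R : realType) (V : finType) (psi : R).
Local Notation Rm := (measurableTypeR R).
Local Notation gam := (@std_gauss R).
Local Notation P0 := (power_sfm gam #|V|).
Local Notation q := ar1_kernel.
Hypothesis psi1 : `|psi| < 1.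

Lemma path_density_cons2 w y (r : seq V) x :
  path_density psi [:: w, y & r] x =
  q psi (field x w) (field x y) * path_density psi (y :: r) x.
Proof. by []. Qed.

Lemma path_density1 w x : path_density psi [:: w : V] x = 1.
Proof. by rewrite /path_density/= mulr1. Qed.

Lemma measurable_kernel_field r u w :
  measurable_fun setT (fun x : config R V => q r (field x u) (field x w)).
Proof. by apply: measurable_ar1_kernel; exact: measurable_field. Qed.

(** On a path without repetition the first node enters only the first kernel, which integrates to
    1. *)
Lemma integral_path_density (S : seq V) : uniq S ->
  (\int[P0]_x (path_density psi S x)%:E = 1)%E.
Proof.
have int1 : (\int[P0]_x 1%:E = 1)%E by rewrite integral_cst// mul1e; exact: power_sfm_setT.
elim: S => [|w [|y r] IH] uS.
- by rewrite -[RHS]int1; apply: eq_integral.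
- by rewrite -[RHS]int1; apply: eq_integral => x _; rewrite path_density1.
move: uS; rewrite cons_uniq => /andP[wr ur].
have wy : y != w by move: wr; rewrite in_cons negb_or eq_sym => /andP[].
under eq_integral do rewrite path_density_cons2 mulrC.
rewrite (@integrate_out_eq _ _ w _ _ _ _ _ _ _ (fun=> 1)).
- by under eq_integral do rewrite mulr1; exact: IH.
- exact: measurable_path_density.
- exact: measurable_kernel_field.
- by move=> x; exact: path_density_ge0.
- by move=> x; exact: ar1_kernel_ge0.
- by move=> x z; exact: path_density_set_field.
- move=> x; under eq_integral.
    by move=> z _; rewrite field_set_field_id field_set_field (negbTE wy) ar1_kernelC; over.
  exact: integral_ar1_kernel.
Qed.

(** The constant kappa, the cost of one edge in [integral_sqrt_path_density]. *)
Definition sqrt_bound := Num.sqrt 2 * Num.sqrt (Num.sqrt (1 - psi ^+ 2)).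

Lemma measurable_sqrtr : measurable_fun setT (@Num.sqrt R).
Proof. by apply: continuous_measurable_fun; exact: sqrt_continuous. Qed.

Lemma integral_sqrt_path_density (S : seq V) : uniq S ->
  (\int[P0]_x (Num.sqrt (path_density psi S x))%:E
   <= (sqrt_bound ^+ (size S).-1)%:E)%E.
Proof.
have int1 : (\int[P0]_x 1%:E = 1)%E by rewrite integral_cst// mul1e; exact: power_sfm_setT.
elim: S => [|w [|y r] IH] uS.
- by rewrite expr0 -[leRHS]int1; under eq_integral do rewrite /path_density/= sqrtr1.
- by rewrite expr0 -[leRHS]int1; under eq_integral do rewrite path_density1 sqrtr1.
move: uS; rewrite cons_uniq => /andP[wr ur].
have wy : y != w by move: wr; rewrite in_cons negb_or eq_sym => /andP[].
under eq_integral do rewrite path_density_cons2 mulrC sqrtrM ?path_density_ge0//.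
apply: (@le_trans _ _ (\int[P0]_x (Num.sqrt (path_density psi (y :: r) x) * sqrt_bound)%:E)%E).
  apply: (@integrate_out_le _ _ w) => //.
  - by apply: measurableT_comp; [exact: measurable_sqrtr|exact: measurable_path_density].
  - by apply: measurableT_comp; [exact: measurable_sqrtr|exact: measurable_kernel_field].
  - by move=> x z; rewrite path_density_set_field.
  - move=> x; under eq_integral.
      by move=> z _; rewrite field_set_field_id field_set_field (negbTE wy) ar1_kernelC; over.
    exact: integral_sqrt_ar1_kernel.
have b0 : 0 <= sqrt_bound by rewrite mulr_ge0 ?sqrtr_ge0.
under eq_integral do rewrite EFinM.
rewrite ge0_integralZr//; last first.
- apply/measurable_EFinP.
  by apply: measurableT_comp; [exact: measurable_sqrtr|exact: measurable_path_density].
rewrite -[(size _).-1]/(size r).+1 exprSr [leRHS]EFinM.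
by apply: lee_pmul; rewrite ?lee_fin//; [exact: integral_ge0|exact: IH].
Qed.


(* Nodes of two distinct pairs are distinct: paths meet only at equal times. *)
Fixpoint levelled (zs : seq (V * V)) : bool :=
  if zs is z :: r then
    [&& z.1 \notin unzip1 r ++ unzip2 r, z.2 \notin unzip1 r ++ unzip2 r
      & levelled r]
  else true.

Definition pair_density (zs : seq (V * V)) (x : config R V) : R :=
  path_density psi (unzip1 zs) x * path_density psi (unzip2 zs) x.

Definition meet : pred (V * V) := fun z => z.1 == z.2.

Lemma pair_density_ge0 zs x : 0 <= pair_density zs x.
Proof. by rewrite mulr_ge0 ?path_density_ge0. Qed.

Lemma measurable_pair_density zs : measurable_fun setT (pair_density zs).
Proof. by apply: measurable_funM; exact: measurable_path_density. Qed.

Lemma pair_density1 z x : pair_density [:: z] x = 1.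
Proof. by rewrite /pair_density !path_density1 mulr1. Qed.

Lemma pair_density_cons2 z z' r x : pair_density [:: z, z' & r] x =
  q psi (field x z.1) (field x z'.1) * q psi (field x z.2) (field x z'.2) *
  pair_density (z' :: r) x.
Proof. by rewrite /pair_density mulrACA. Qed.

Lemma pair_density_set_field zs v x y : v \notin unzip1 zs ++ unzip2 zs ->
  pair_density zs (set_field v x y) = pair_density zs x.
Proof.
by rewrite mem_cat negb_or => /andP[v1 v2]; rewrite /pair_density !path_density_set_field.
Qed.

Variable a : R.
Hypotheses (a01 : 0 < a <= 1) (psia : psi ^+ 2 <= a / 32).

(* The weight expR (a / 8 * x ^+ 2) absorbs the unbounded factor produced by
   integrating the squared kernel, up to the constant 1 + a. *)
Definition weight v (x : config R V) : R := expR (a / 8 * field x v ^+ 2).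

Lemma measurable_weight v : measurable_fun setT (weight v).
Proof.
apply: (measurableT_comp (@measurable_expR R)); apply: measurable_funM => //.
by apply: measurable_funX; exact: measurable_field.
Qed.

Lemma weight_ge0 v x : 0 <= weight v x.
Proof. exact: expR_ge0. Qed.

Lemma weight_set_field v w x y : v != w ->
  weight v (set_field w x y) = weight v x.
Proof. by move=> vw; rewrite /weight field_set_field (negbTE vw). Qed.

(* Once the nodes before the current pair z have been integrated out since the
   last meeting node v, two kernels tie v to z; r is the power of psi accumulated
   on the way. *)
Definition tethered (r : R) (v : V) (zs : seq (V * V)) (x : config R V) : R :=
  let z := head (v, v) zs in
  pair_density zs x *
  (q r (field x v) (field x z.1) * q r (field x v) (field x z.2) * weight v x).

Lemma integral_weight v : (\int[P0]_x (weight v x)%:E <= (1 + a)%:E)%E.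
Proof.
have /andP[a0 _] := a01.
apply: (@le_trans _ _ (\int[P0]_x (1 * (1 + a))%:E)%E); last first.
  by rewrite mul1r integral_cst// [X in (_ * X)%E](_ : _ = 1%E) ?mule1//; exact: power_sfm_setT.
under eq_integral do rewrite -[weight v _]mul1r.
apply: (@integrate_out_le _ _ v) => //.
- exact: measurable_weight.
- by move=> x; exact: weight_ge0.
- move=> x; under eq_integral do rewrite /weight field_set_field_id.
  exact: integral_expR_sqr.
Qed.

(** At a meeting the two tethering kernels coincide, so integrating out [v] meets a squared kernel:
    by [integral_sqr_ar1_kernel] the weight moves from [v] to [w] at the cost [1 + a]. *)
Lemma integral_tethered_meet r v w zs : r ^+ 2 <= a / 32 ->
  v \notin w :: unzip1 zs ++ unzip2 zs ->
  (\int[P0]_x (tethered r v ((w, w) :: zs) x)%:E <=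
   (1 + a)%:E * \int[P0]_x (pair_density ((w, w) :: zs) x * weight w x)%:E)%E.
Proof.
move=> ra; rewrite in_cons negb_or => /andP[vw vzs]; have /andP[a0 _] := a01.
rewrite -ge0_integralZl//; last 3 first.
- apply/measurable_EFinP; apply: measurable_funM; last exact: measurable_weight.
  exact: measurable_pair_density.
- by move=> x _; rewrite lee_fin mulr_ge0 ?pair_density_ge0 ?weight_ge0.
- by rewrite lee_fin addr_ge0// ltW.
under [leRHS]eq_integral do rewrite -EFinM mulrCA.
apply: (@integrate_out_le _ _ v).
- exact: measurable_pair_density.
- apply: measurable_funM; last exact: measurable_weight.
  by apply: measurable_funM; exact: measurable_kernel_field.
- by move=> x; exact: pair_density_ge0.
- move=> x; apply: mulr_ge0; last exact: weight_ge0.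
  by apply: mulr_ge0; exact: ar1_kernel_ge0.
- move=> x y; rewrite pair_density_set_field//=.
  by move: vzs; rewrite !(mem_cat, in_cons) (negbTE vw) => /negbTE ->.
- by apply: measurable_funM => //; exact: measurable_weight.
- move=> x; rewrite /weight /=.
  under eq_integral do rewrite field_set_field_id field_set_field eq_sym (negbTE vw) -expr2.
  exact: integral_sqr_ar1_kernel.
Qed.


Lemma small_norm_lt1 r : r ^+ 2 <= a / 32 -> `|r| < 1.
Proof.
move=> ra; have /andP[a0 a1] := a01.
rewrite -(ltr_pXn2r (ltn0Sn 1)) ?nnegrE// expr1n real_normK ?num_real//; lra.
Qed.

(** Each tethering kernel ends at its own node and integrates to 1, which leaves only the weight. *)
Lemma integral_tethered_one r v w w' : r ^+ 2 <= a / 32 -> w != w' ->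
  v != w -> v != w' ->
  (\int[P0]_x (tethered r v [:: (w, w')] x)%:E <= (1 + a)%:E)%E.
Proof.
move=> ra ww' vw vw'; have r1 := small_norm_lt1 ra.
have E x : tethered r v [:: (w, w')] x =
    weight v x * q r (field x v) (field x w') * q r (field x v) (field x w).
  by rewrite /tethered pair_density1 /=; ring.
under eq_integral do rewrite E.
rewrite (@integrate_out_eq _ _ w _ _ _ _ _ _ _ (fun=> 1)).
- under eq_integral do rewrite mulr1.
  rewrite (@integrate_out_eq _ _ w' _ _ _ _ _ _ _ (fun=> 1)).
  + by under eq_integral do rewrite mulr1; exact: integral_weight.
  + exact: measurable_weight.
  + exact: measurable_kernel_field.
  + by move=> x; exact: weight_ge0.
  + by move=> x; exact: ar1_kernel_ge0.
  + by move=> x y; rewrite weight_set_field.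
  + move=> x; under eq_integral do rewrite field_set_field_id field_set_field (negbTE vw').
    exact: integral_ar1_kernel.
- by apply: measurable_funM; [exact: measurable_weight|exact: measurable_kernel_field].
- exact: measurable_kernel_field.
- by move=> x; apply: mulr_ge0; [exact: weight_ge0|exact: ar1_kernel_ge0].
- by move=> x; exact: ar1_kernel_ge0.
- move=> x y; rewrite weight_set_field//= !field_set_field (negbTE vw) eq_sym (negbTE ww').
  by [].
- move=> x; under eq_integral do rewrite field_set_field_id field_set_field (negbTE vw).
  exact: integral_ar1_kernel.
Qed.

(** Away from meetings both nodes are integrated out by the semigroup property: the tethers
    lengthen, [r] becomes [r * psi], and nothing is lost. *)
Lemma integral_tethered_step r v w w' y y' zs : r ^+ 2 <= a / 32 -> w != w' ->
  levelled [:: (w, w'), (y, y') & zs] ->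
  v \notin unzip1 [:: (w, w'), (y, y') & zs] ++ unzip2 [:: (w, w'), (y, y') & zs] ->
  (\int[P0]_x (tethered r v [:: (w, w'), (y, y') & zs] x)%:E =
   \int[P0]_x (tethered (r * psi) v ((y, y') :: zs) x)%:E)%E.
Proof.
move=> ra ww' /= /and3P[wn w'n _]; have r1 := small_norm_lt1 ra.
rewrite !(mem_cat, in_cons) !negb_or => /andP[vw /and5P[vy vzs vw' vy' vzs']].
have E x : tethered r v [:: (w, w'), (y, y') & zs] x =
    (pair_density ((y, y') :: zs) x * weight v x *
      (q r (field x v) (field x w') * q psi (field x w') (field x y'))) *
    (q r (field x v) (field x w) * q psi (field x w) (field x y)).
  by rewrite /tethered pair_density_cons2 /=; ring.
have [wy wy'] : y != w /\ y' != w.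
  by move: wn; rewrite !(mem_cat, in_cons) !negb_or ![w == _]eq_sym => /and4P[].
have [w'y w'y'] : y != w' /\ y' != w'.
  by move: w'n; rewrite !(mem_cat, in_cons) !negb_or ![w' == _]eq_sym => /and4P[].
under eq_integral do rewrite E.
have mkk r1' r2' u1 u2 u3 u4 : measurable_fun setT (fun x : config R V =>
    q r1' (field x u1) (field x u2) * q r2' (field x u3) (field x u4)).
  by apply: measurable_funM; exact: measurable_kernel_field.
have kk0 r1' r2' u1 u2 u3 u4 (x : config R V) :
    0 <= q r1' (field x u1) (field x u2) * q r2' (field x u3) (field x u4).
  by apply: mulr_ge0; exact: ar1_kernel_ge0.
have mpw : measurable_fun setT (fun x => pair_density ((y, y') :: zs) x * weight v x).
  by apply: measurable_funM; [exact: measurable_pair_density|exact: measurable_weight].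
have pw0 x : 0 <= pair_density ((y, y') :: zs) x * weight v x.
  by apply: mulr_ge0; [exact: pair_density_ge0|exact: weight_ge0].
rewrite (@integrate_out_eq _ _ w _ _ _ _ _ _ _
  (fun x => q (r * psi) (field x v) (field x y))).
- under eq_integral do rewrite mulrAC.
  rewrite (@integrate_out_eq _ _ w' _ _ _ _ _ _ _
    (fun x => q (r * psi) (field x v) (field x y'))).
  + apply: eq_integral => x _; congr EFin; rewrite /tethered/=; ring.
  + by apply: measurable_funM => //; exact: measurable_kernel_field.
  + exact: mkk.
  + by move=> x; apply: mulr_ge0 => //; exact: ar1_kernel_ge0.
  + by move=> x; exact: kk0.
  + move=> x z; rewrite pair_density_set_field// weight_set_field//.
    rewrite !field_set_field (negbTE vw').
    by rewrite (negbTE w'y).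
  + move=> x; under eq_integral do
      rewrite !field_set_field eqxx (negbTE vw') (negbTE w'y').
    exact: integral_ar1_kernel_comp.
- by apply: measurable_funM.
- exact: mkk.
- by move=> x; apply: mulr_ge0.
- by move=> x; exact: kk0.
- move=> x z; rewrite pair_density_set_field// weight_set_field//.
  by rewrite !field_set_field (negbTE vw) (negbTE wy') eq_sym (negbTE ww').
- move=> x; under eq_integral do
    rewrite !field_set_field eqxx (negbTE vw) (negbTE wy).
  exact: integral_ar1_kernel_comp.
Qed.

(** Induction along the pairs: each meeting costs a factor [1 + a], and the weight left at the end
    costs one more, hence the successor in the exponent. *)
Lemma integral_tethered zs z r v : r ^+ 2 <= a / 32 ->
  levelled (z :: zs) -> v \notin unzip1 (z :: zs) ++ unzip2 (z :: zs) ->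
  (\int[P0]_x (tethered r v (z :: zs) x)%:E <=
   ((1 + a) ^+ (count meet (z :: zs)).+1)%:E)%E.
Proof.
have /andP[a0 a1] := a01.
elim: zs z r v => [|[y y'] zs IH] [w w'] r v ra lev vn.
- have [ww'|ww'] := eqVneq w w'; last first.
    move: vn; rewrite /= /meet/= (negbTE ww') !in_cons !in_nil !orbF negb_or expr1.
    by move=> /andP[vw vw']; exact: integral_tethered_one.
  rewrite -ww' in lev vn *.
  apply: (le_trans (integral_tethered_meet ra _)).
    by move: vn; rewrite /= !in_cons !orbF negb_or => /andP[].
  rewrite /= /meet/= eqxx exprS EFinM; apply: lee_pmul => //.
  + by rewrite lee_fin addr_ge0// ltW.
  + by apply: integral_ge0 => x _; rewrite lee_fin mulr_ge0 ?pair_density_ge0 ?weight_ge0.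
  under eq_integral do rewrite pair_density1 mul1r.
  by rewrite expr1; exact: integral_weight.
- have [ww'|ww'] := eqVneq w w'; last first.
    rewrite integral_tethered_step//.
    have -> : count meet [:: (w, w'), (y, y') & zs] = count meet ((y, y') :: zs).
      by rewrite [LHS]/= {1}/meet/= (negbTE ww').
    apply: IH.
    (* A longer tether still satisfies the smallness condition, because [psi ^+ 2] is at most 1. *)
    + rewrite exprMn; apply: (@le_trans _ _ (r ^+ 2 * 1)); last by rewrite mulr1.
      apply: ler_wpM2l; first exact: sqr_ge0.
      by apply: (le_trans psia); lra.
    + by move: lev => /= /and3P[_ _ ->].
    + move: vn; rewrite [X in X -> _]/= !(mem_cat, in_cons) !negb_or.
      by move=> /andP[_ /and5P[-> -> _ -> ->]].
  rewrite -ww' in lev vn *.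
  apply: (le_trans (integral_tethered_meet ra _)).
    move: vn; rewrite /= !(mem_cat, in_cons) !negb_or.
    by move=> /andP[-> /and5P[-> -> _ -> ->]].
  have -> : count meet [:: (w, w), (y, y') & zs] = (count meet ((y, y') :: zs)).+1.
    by rewrite [LHS]/= {1}/meet/= eqxx.
  rewrite exprS EFinM; apply: lee_pmul => //.
  + by rewrite lee_fin addr_ge0// ltW.
  + by apply: integral_ge0 => x _; rewrite lee_fin mulr_ge0 ?pair_density_ge0 ?weight_ge0.
  (* The meeting node [w] becomes the new anchor, and the two edges leaving it are tethers with
     [r = psi]. *)
  rewrite [leLHS](_ : _ = \int[P0]_x (tethered psi w ((y, y') :: zs) x)%:E)%E; last first.
    apply: eq_integral => x _; congr EFin.
    by rewrite /tethered pair_density_cons2/=; ring.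
  move: lev => /= /and3P[wn _ lev].
  exact: IH.
Qed.

(* The common starting node plays the role of a first meeting. *)
Lemma integral_pair_density w zs : levelled ((w, w) :: zs) ->
  (\int[P0]_x (pair_density ((w, w) :: zs) x)%:E <=
   ((1 + a) ^+ (count meet ((w, w) :: zs)))%:E)%E.
Proof.
move=> lev; have /andP[a0 _] := a01.
apply: (@le_trans _ _ (\int[P0]_x (pair_density ((w, w) :: zs) x * weight w x)%:E)%E).
  apply: ge0_le_integral => //.
  - by move=> x _; rewrite lee_fin pair_density_ge0.
  - by apply/measurable_EFinP; exact: measurable_pair_density.
  - apply/measurable_EFinP; apply: measurable_funM; last exact: measurable_weight.
    exact: measurable_pair_density.
  - move=> x _; rewrite lee_fin ler_peMr ?pair_density_ge0// /weight -[leLHS]expR0 ler_expR.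
    by rewrite mulr_ge0 ?sqr_ge0// divr_ge0 ?ltW.
have -> : count meet ((w, w) :: zs) = (count meet zs).+1 by rewrite /= {1}/meet eqxx.
case: zs lev => [|[y y'] zs] lev.
  by under eq_integral do rewrite pair_density1 mul1r; exact: integral_weight.
rewrite [leLHS](_ : _ = \int[P0]_x (tethered psi w ((y, y') :: zs) x)%:E)%E; last first.
  apply: eq_integral => x _; congr EFin.
  by rewrite /tethered pair_density_cons2/=; ring.
move: lev => /= /and3P[wn _ lev].
exact: integral_tethered.
Qed.

End moments.

(** * An unpredictable monotone walk *)

Section slots.
Local Open Scope nat_scope.

(* The slot s is devoted to the scale j for which 2 ^ j divides s.+1 exactly, so
   that a block of 2 * 8 ^ j slots has 4 ^ j slots of scale j, which slot_rank
   enumerates. *)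
Definition slot_scale s := logn 2 s.+1.
Definition slot_block s := s %/ (2 * 8 ^ slot_scale s).
Definition slot_rank s := (s %% (2 * 8 ^ slot_scale s)) %/ 2 ^ (slot_scale s).+1.

(** The slot of scale [j], block [i] and rank [r]: its successor is [2 ^ j] times the odd number
    [2 * (4 ^ j * i + r) + 1]. *)
Definition slot j i r := 2 * 8 ^ j * i + (2 ^ j.+1 * r + (2 ^ j).-1).

Lemma slot_scaleE j i r : slot_scale (slot j i r) = j.
Proof.
have e : (slot j i r).+1 = 2 ^ j * (2 * (4 ^ j * i + r)).+1.
  rewrite /slot (_ : 8 ^ j = 2 ^ j * 4 ^ j); last by rewrite -expnMn.
  have : 0 < 2 ^ j by rewrite expn_gt0.
  rewrite expnS; move: (2 ^ j) (4 ^ j) => x y; lia.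
rewrite /slot_scale e lognM ?expn_gt0// lognX logn_prime// eqxx muln1.
by rewrite logn_coprime ?addn0// coprime2n /= oddM.
Qed.

Lemma slot_offset_lt j r : r < 4 ^ j -> 2 ^ j.+1 * r + (2 ^ j).-1 < 2 * 8 ^ j.
Proof.
rewrite (_ : 8 ^ j = 2 ^ j * 4 ^ j); last by rewrite -expnMn.
have : 0 < 2 ^ j by rewrite expn_gt0.
rewrite expnS; move: (2 ^ j) (4 ^ j) => x y; nia.
Qed.

Lemma slot_blockE j i r : r < 4 ^ j -> slot_block (slot j i r) = i.
Proof.
move=> rj; rewrite /slot_block slot_scaleE /slot mulnC divnMDl; last first.
  by rewrite muln_gt0 expn_gt0.
by rewrite divn_small ?addn0// slot_offset_lt.
Qed.

Lemma slot_rankE j i r : r < 4 ^ j -> slot_rank (slot j i r) = r.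
Proof.
move=> rj; rewrite /slot_rank slot_scaleE /slot mulnC modnMDl.
rewrite modn_small ?slot_offset_lt// mulnC divnMDl ?expn_gt0//.
rewrite divn_small ?addn0// expnS.
have : 0 < 2 ^ j by rewrite expn_gt0.
by lia.
Qed.

Lemma slot_scale_le s : slot_scale s <= s.
Proof.
have := ltn_expl (slot_scale s) (isT : 1 < 2).
have : 2 ^ slot_scale s <= s.+1 by apply: dvdn_leq => //; exact: pfactor_dvdnn.
by lia.
Qed.

Lemma slot_block_le s : slot_block s <= s.
Proof. exact: leq_div. Qed.

Lemma slot_lt j i r : r < 4 ^ j -> slot j i r < 2 * 8 ^ j * i.+1.
Proof. by move=> rj; rewrite /slot mulnSr ltn_add2l slot_offset_lt. Qed.

End slots.

Section walk.
Variable K : nat.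

(* The scale-j displacements over the i-th block of length 4 * 8 ^ j, in the
   first two coordinates; they are read modulo 4 ^ j. *)
Definition coins : finType :=
  {ffun 'I_K.+1 * 'I_K.+1 -> 'I_(4 ^ K) * 'I_(4 ^ K)}.

(** One alphabet of size [4 ^ K] serves all scales: for [j <= K] it is divisible by [4 ^ j], so a
    uniform letter has a uniform residue. *)
Definition coin (w : coins) (c : bool) (j i : nat) : nat :=
  let u := w (inord j, inord i) in ((if c then u.2 else u.1) %% 4 ^ j)%N.

(* Each slot consists of two consecutive times, one for each of the first two
   coordinates; a time with no increment moves the third coordinate. *)
Definition incr (w : coins) (t : nat) (c : bool) : bool :=
  let s := t./2 in
  (odd t == c) && (slot_rank s < coin w c (slot_scale s) (slot_block s))%N.

Definition displ (w : coins) (t : nat) (c : bool) : nat :=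
  (\sum_(t' < t) incr w t' c)%N.

Definition set_coin (w : coins) a u : coins :=
  [ffun b => if b == a then u else w b].

Lemma set_coin_id w a u : set_coin w a u a = u.
Proof. by rewrite ffunE eqxx. Qed.

Lemma coin_set_other w j i u c j' i' :
  (j <= K -> i <= K -> j' <= K -> i' <= K ->
  (j', i') != (j, i) -> 
  coin (set_coin w (inord j, inord i) u) c j' i' = coin w c j' i')%N.
Proof.
move=> jK iK j'K i'K ne; rewrite /coin ffunE; case: eqP => // -[ej ei].
move: ne; have := congr1 val ej; have := congr1 val ei.
by rewrite /= !inordK ?ltnS// => -> ->; rewrite eqxx.
Qed.

Lemma incr_set_coin_other w j i u c t : (j <= K -> i <= K -> t <= K ->
  (slot_scale t./2, slot_block t./2) != (j, i) ->
  incr (set_coin w (inord j, inord i) u) t c = incr w t c)%N.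
Proof.
move=> jK iK tK ne; rewrite /incr coin_set_other//.
- by apply: leq_trans (slot_scale_le _) _; lia.
- by apply: leq_trans (slot_block_le _) _; lia.
Qed.

Lemma incr_set_coin w j i u c t : (j <= K -> i <= K ->
  (slot_scale t./2, slot_block t./2) = (j, i) ->
  incr (set_coin w (inord j, inord i) u) t c =
  (odd t == c) && (slot_rank t./2 < (if c then u.2 else u.1) %% 4 ^ j))%N.
Proof. by move=> jK iK [ej ei]; rewrite /incr /coin ej ei ffunE eqxx. Qed.

(** A block of scale [j] lasts [2 * 8 ^ j] slots of two times each, so the coin of block [i] is
    first read no earlier than time [4 * 8 ^ j * i]. The past is thus independent of that coin. *)
Lemma displ_set_coin_before w j i u c t : (j <= K -> i <= K -> t <= K ->
  t <= 4 * 8 ^ j * i ->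
  displ (set_coin w (inord j, inord i) u) t c = displ w t c)%N.
Proof.
move=> jK iK tK ti; apply: eq_bigr => t' _; rewrite incr_set_coin_other//.
  by apply: leq_trans (ltnW (ltn_ord t')) tK.
apply/eqP => -[ej ei].
have := ltn_ord t'; have := leq_trunc_div t'./2 (2 * 8 ^ j).
rewrite -[X in (X * _ <= _)%N]/(t'./2 %/ (2 * 8 ^ j))%N -{1}ej -/(slot_block _) ei.
by lia.
Qed.

(* After a full block the displacement determines its coin modulo 4 ^ j. *)
Lemma displ_set_coin_lt w j i (u u' : 'I_(4 ^ K) * 'I_(4 ^ K)) (c : bool) t : (j <= K -> i <= K -> t <= K ->
  4 * 8 ^ j * i.+1 <= t ->
  (if c then u.2 else u.1) %% 4 ^ j < (if c then u'.2 else u'.1) %% 4 ^ j ->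
  displ (set_coin w (inord j, inord i) u) t c <
  displ (set_coin w (inord j, inord i) u') t c)%N.
Proof.
move=> jK iK tK it uu.
set r := ((if c then u.2 else u.1) %% 4 ^ j)%N in uu *.
have r4 : (r < 4 ^ j)%N by rewrite ltn_pmod ?expn_gt0.
(* The slot whose rank is the smaller coin yields an increment under [u'] but not under [u]; every
   other increment is nondecreasing in the coin. *)
pose s := slot j i r.
have sE : ((c + s.*2)./2 = s)%N by rewrite half_bit_double.
have st : (c + s.*2 < t)%N.
  have := slot_lt i r4; rewrite -/s; case: (c) => /=; lia.
rewrite /displ (bigD1 (Ordinal st))//= [X in (_ < X)%N](bigD1 (Ordinal st))//=.
rewrite !incr_set_coin ?sE ?slot_scaleE ?slot_blockE//.
rewrite oddD oddb odd_double addbF eqxx slot_rankE// -/r ltnn uu add0n add1n ltnS.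
apply: leq_sum => t' _.
have [e|ne] := eqVneq (slot_scale t'./2, slot_block t'./2) (j, i); last first.
  by rewrite !incr_set_coin_other// (leq_trans (ltnW (ltn_ord t')) tK).
rewrite !incr_set_coin// -/r; case: (odd t' == c) => //=.
by case: ltnP => // h; rewrite (ltn_trans h uu).
Qed.

(** A prescribed position fixes the residues modulo [4 ^ j] of both components of the coin, so only
    their quotients remain free. *)
Lemma card_set_coin_hits w j i t (x : bool -> nat) : (j <= K -> i <= K -> t <= K ->
  4 * 8 ^ j * i.+1 <= t ->
  #|[set u | [forall c, displ (set_coin w (inord j, inord i) u) t c == x c]]%SET|
    <= (4 ^ (K - j)) ^ 2)%N.
Proof.
move=> jK iK tK it.
have dlt (v : 'I_(4 ^ K)) : (v %/ 4 ^ j < 4 ^ (K - j))%N.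
  by rewrite ltn_divLR ?expn_gt0// -expnD subnK.
pose f (u : 'I_(4 ^ K) * 'I_(4 ^ K)) := (Ordinal (dlt u.1), Ordinal (dlt u.2)).
set A := [set u | _]%SET.
have fI : {in A &, injective f}.
  move=> u u'; rewrite !inE => /forallP uA /forallP u'A [e1 e2].
  have emod c : ((if c then u.2 else u.1) %% 4 ^ j = (if c then u'.2 else u'.1) %% 4 ^ j)%N.
    apply/eqP; rewrite eqn_leq; apply/andP; split; rewrite leqNgt; apply/negP => h.
    - have := displ_set_coin_lt (u := u') (u' := u) w jK iK tK it h.
      by rewrite (eqP (uA c)) (eqP (u'A c)) ltnn.
    - have := displ_set_coin_lt (u := u) (u' := u') w jK iK tK it h.
      by rewrite (eqP (uA c)) (eqP (u'A c)) ltnn.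
  case: u u' e1 e2 emod {uA u'A} => [u1 u2] [v1 v2] /= e1 e2 emod.
  congr pair; apply: val_inj.
  - by rewrite /= (divn_eq u1 (4 ^ j)) e1 (emod false) -divn_eq.
  - by rewrite /= (divn_eq u2 (4 ^ j)) e2 (emod true) -divn_eq.
rewrite -(card_in_imset fI) -mulnn.
by apply: leq_trans (max_card _) _; rewrite card_prod !card_ord.
Qed.

End walk.

(** * Hitting probabilities and exponential moments of the number of hits *)

Section hits.
Variables (R : realType) (K : nat).
Local Notation coins := (coins K).
Local Notation die := ('I_(4 ^ K) * 'I_(4 ^ K))%type.

(** Resampling a coin preserves the uniform law: exchanging the fresh value with the old one is an
    involution. *)
Lemma sum_set_coin (F : coins -> R) a :
  \sum_w \sum_(u : die) F (set_coin w a u) = #|{: die}|%:R * \sum_w F w.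
Proof.
rewrite pair_big/=.
pose swap (p : coins * die) := (set_coin p.1 a p.2, p.1 a).
have swapK : involutive swap.
  move=> [w u]; rewrite /swap/= set_coin_id; congr pair; apply/ffunP => b.
  by rewrite !ffunE; case: eqP => // ->.
rewrite (reindex_inj (inv_inj swapK))/=.
under eq_bigr => p _.
  have -> : set_coin (set_coin p.1 a p.2) a (p.1 a) = p.1.
    by apply/ffunP => b; rewrite !ffunE; case: eqP => // ->.
  over.
rewrite -(pair_bigA _ (fun w _ => F w))/= mulr_sumr.
by apply: eq_bigr => w _; rewrite sumr_const mulr_natl.
Qed.

Definition hit (x : bool -> nat) (w : coins) t : bool :=
  [forall c, displ w t c == x c].

Definition adapted n (W : coins -> R) := forall w w',
  (forall t c, (t <= n)%N -> displ w t c = displ w' t c) -> W w = W w'.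

(* A gap g contains a full block of scale j as soon as 8 ^ j.+1 <= g. *)
Definition predictability g : R := 16 / 16 ^+ trunc_log 8 g.
Local Notation p := predictability.

Lemma predictability_ge0 g : 0 <= p g.
Proof. by rewrite divr_ge0// exprn_ge0. Qed.

(** A long gap after time [n] contains a full block, whose coin [W] does not see. Resampling this
    coin alone, the fraction of its values that lead to the prescribed position is at most
    [16 ^- j]. *)
Lemma sum_hit_le n g x (W : coins -> R) : (n + g <= K)%N ->
  (forall w, 0 <= W w) -> adapted n W ->
  \sum_w (hit x w (n + g))%:R * W w <= p g * \sum_w W w.
Proof.
move=> ngK W0 Wn; rewrite /p.
(* For gaps below 8 the factor is 16, and bounding the hit indicator by 1 suffices. *)
case E : (trunc_log 8 g) => [|j].
  rewrite expr0 divr1 mulr_sumr; apply: ler_sum => w _.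
  by apply: ler_wpM2r => //; case: (hit _ _ _); rewrite ?ler1n// ler0n.
have g0 : (0 < g)%N by case: (g) E.
have /andP[jg _] : (8 ^ j.+1 <= g < 8 ^ (j.+1).+1)%N.
  by rewrite -E; apply: trunc_log_bounds.
pose B := (4 * 8 ^ j)%N.
have B0 : (0 < B)%N by rewrite muln_gt0 expn_gt0.
(* The first block starting at or after [n]; it ends by [n + 2 * B - 1], which is before
   [n + 8 ^ j.+1]. *)
pose i := ((n + B.-1) %/ B)%N.
have ni : (n <= B * i)%N.
  have := ltn_pmod (n + B.-1) B0; have := divn_eq (n + B.-1) B; rewrite -/i; lia.
have iB : (B * i.+1 <= n + g)%N.
  have := leq_trunc_div (n + B.-1) B; rewrite -/i.
  by move: jg; rewrite expnS /B; move: (8 ^ j)%N => y; lia.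
have jK : (j <= K)%N.
  have : (j < 8 ^ j)%N by exact: ltn_expl.
  by move: jg; rewrite expnS; move: (8 ^ j)%N => y; lia.
have iK : (i <= K)%N.
  apply: leq_trans (leq_trans iB ngK).
  exact: leq_trans (leqnSn i) (leq_pmull _ B0).
pose a : 'I_K.+1 * 'I_K.+1 := (inord j, inord i).
have Wset w u : W (set_coin w a u) = W w.
  apply: Wn => t c tn; apply: displ_set_coin_before => //; last first.
    by apply: leq_trans tn _.
  by apply: leq_trans tn _; apply: leq_trans (leq_addr _ _) ngK.
have cardU : #|{: die}|%:R = 16 ^+ j * ((4 ^ (K - j)) ^ 2)%N%:R :> R.
  rewrite card_prod !card_ord mulnn -(subnK jK) addnK expnD expnMn natrM mulrC.
  by congr (_ * _); rewrite -expnM mulnC expnM natrX.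
have U0 : 0 < #|{: die}|%:R :> R by rewrite cardU mulr_gt0 ?exprn_gt0// ltr0n !expn_gt0.
rewrite -(ler_pM2l U0) -(sum_set_coin _ a) cardU.
set C := (_ ^ 2)%N.
have z16 : 16 ^+ j != 0 :> R by rewrite expf_neq0.
rewrite [leRHS](_ : _ = C%:R * \sum_w W w); last by rewrite exprS; field; rewrite z16.
rewrite mulr_sumr.
apply: ler_sum => w _.
under eq_bigr => u _ do rewrite Wset.
rewrite -mulr_suml; apply: ler_wpM2r => //.
rewrite -natr_sum ler_nat.
apply: leq_trans (card_set_coin_hits w x jK iK ngK iB).
rewrite -sum1_card [leqRHS]big_mkcond; apply: leq_sum => u _.
by rewrite inE -/a /hit; case: ifP.
Qed.

(** The [7 * 8 ^ l] gaps from [8 ^ l] up to [8 ^ l.+1] have the constant bound [16 / 16 ^+ l] and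
    contribute [112 * 2 ^- l]; the geometric series has total 224. *)
Lemma sum_predictability_exp l :
  \sum_(1 <= g < 8 ^ l) p g <= 224 * (1 - 2 ^- l).
Proof.
elim: l => [|l IH]; first by rewrite big_geq// expr0 invr1 subrr mulr0.
rewrite (big_cat_nat (n := 8 ^ l)) ?expn_gt0 ?leq_exp2l//=.
have -> : \sum_(8 ^ l <= g < 8 ^ l.+1) p g = 112 * 2 ^- l :> R.
  rewrite (eq_big_nat _ _ (F2 := fun=> 16 / 16 ^+ l)); last first.
    by move=> g gl; rewrite /p (trunc_log_eq _ gl).
  rewrite sumr_const_nat expnS -[X in (_ - X)%N]mul1n -mulnBl (_ : (8 - 1)%N = 7)// -[LHS]mulr_natr natrM natrX.
  have -> : 16 ^+ l = 2 ^+ l * 8 ^+ l :> R by rewrite -exprMn; congr (_ ^+ _); ring.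
  by field; rewrite !expf_neq0 ?pnatr_eq0.
apply: (le_trans (lerD IH (lexx _))); rewrite exprS invfM; lra.
Qed.

Lemma sum_predictability n : \sum_(1 <= g < n) p g <= 224.
Proof.
have nl : (n <= 8 ^ n)%N by apply: ltnW; exact: ltn_expl.
apply: (@le_trans _ _ (\sum_(1 <= g < 8 ^ n) p g)).
  case: (posnP n) => [->|n0]; first by rewrite big_geq.
  rewrite [leRHS](big_cat_nat (n := n))//= lerDl.
  by apply: sumr_ge0 => g _; exact: predictability_ge0.
apply: (le_trans (sum_predictability_exp n)).
by rewrite -[leRHS]mulr1 ler_wpM2l// lerBlDr lerDl invr_ge0 exprn_ge0.
Qed.

Variables (a : R) (x : nat -> bool -> nat).
Hypotheses (a0 : 0 <= a) (a1 : a * 224 <= 4^-1).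

(** The number [1 + a] to the power of the number of hits of the trajectory [x] at times 1, ..., T -
    1. Time 0, where two walks always agree, is left out. *)
Definition hit_weight T (w : coins) : R :=
  \prod_(1 <= t < T) (1 + a * (hit (x t) w t)%:R).

Lemma hit_weight_ge0 T w : 0 <= hit_weight T w.
Proof. by apply: prodr_ge0 => t _; rewrite addr_ge0// mulr_ge0. Qed.

Lemma adapted_hit_weight t : adapted t (hit_weight t).
Proof.
move=> w w' ww'; apply: eq_big_nat => u /andP[_ ut]; rewrite /hit.
by congr (1 + a * (nat_of_bool _)%:R); apply: eq_forallb => c; rewrite ww'// ltnW.
Qed.

Lemma adapted_hit t : adapted t (fun w => (hit (x t) w t)%:R * hit_weight t w).
Proof.
move=> w w' ww'; rewrite (adapted_hit_weight ww'); congr ((nat_of_bool _)%:R * _).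
by apply: eq_forallb => c; rewrite ww'.
Qed.

(** Telescoping of the product: the factor at time [t] adds [a] times the hit at [t] weighted by the
    strict past, a form to which [sum_hit_le] applies. *)
Lemma hit_weightE T w : hit_weight T w =
  1 + a * \sum_(1 <= t < T) (hit (x t) w t)%:R * hit_weight t w.
Proof.
elim: T => [|T IH]; first by rewrite /hit_weight !big_geq// mulr0 addr0.
case: (posnP T) IH => [->|T0] IH; first by rewrite /hit_weight !big_geq// mulr0 addr0.
rewrite [in RHS]big_nat_recr//= [a * (_ + _)]mulrDr addrA -IH.
by rewrite [in LHS]/hit_weight big_nat_recr//= -/(hit_weight T w); ring.
Qed.

Let f t := \sum_w (hit (x t) w t)%:R * hit_weight t w.

Let f_ge0 t : 0 <= f t.
Proof. by apply: sumr_ge0 => w _; rewrite mulr_ge0// hit_weight_ge0. Qed.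

(** A renewal inequality: the weight before [t] is expanded over earlier hits [u] by [hit_weightE],
    and each return from [u] to [t] is bounded by [sum_hit_le]. *)
Let f_rec t : (t <= K)%N ->
  f t <= p t * #|coins|%:R + a * \sum_(1 <= u < t) p (t - u) * f u.
Proof.
move=> tK; rewrite /f.
under eq_bigr => w _.
  rewrite hit_weightE mulrDr mulr1 mulrCA mulr_sumr.
  over.
rewrite big_split/=; apply: lerD.
  rewrite [leLHS](_ : _ = \sum_w (hit (x t) w (0 + t))%:R * 1); last first.
    by apply: eq_bigr => w _; rewrite mulr1.
  by apply: (le_trans (sum_hit_le (W := fun=> 1) _ _ _ _)); rewrite ?sumr_const.
rewrite -mulr_sumr; apply: ler_wpM2l => //.
rewrite exchange_big/=; apply: ler_sum_nat => u /andP[_ ut].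
rewrite -[in leLHS](subnKC (ltnW ut)).
apply: sum_hit_le.
- by rewrite subnKC// ltnW.
- by move=> w; rewrite mulr_ge0// hit_weight_ge0.
- exact: adapted_hit.
Qed.

Let F T := \sum_(1 <= t < T) f t.

Let F_ge0 T : 0 <= F T.
Proof. by apply: sumr_ge0. Qed.

(** Sum of the renewal inequality over [t]: after exchanging the sums, the convolution with [p]
    costs at most its total mass 224. *)
Let F_le T : (T <= K.+1)%N -> F T <= 224 * #|coins|%:R + a * (224 * F T).
Proof.
move=> TK.
apply: (@le_trans _ _ (\sum_(1 <= t < T)
    (p t * #|coins|%:R + a * \sum_(1 <= u < t) p (t - u) * f u))).
  by apply: ler_sum_nat => t /andP[_ tT]; apply: f_rec; rewrite -ltnS (leq_trans tT).
rewrite big_split/= -mulr_suml -[X in _ + X <= _]mulr_sumr; apply: lerD.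
  by apply: ler_wpM2r => //; exact: sum_predictability.
apply: ler_wpM2l => //.
rewrite (eq_big_nat _ _ (F2 := fun t => \sum_(1 <= u < T | (u < t)%N) p (t - u) * f u)); last first.
  by move=> t /andP[_ tT]; rewrite (big_nat_widen _ _ T) ?(ltnW tT).
rewrite (exchange_big_dep_nat xpredT)//= /F mulr_sumr.
apply: ler_sum_nat => u /andP[u1 uT].
rewrite -mulr_suml; apply: ler_wpM2r => //.
apply: le_trans _ (sum_predictability (T - u)).
rewrite [leLHS](_ : _ = \sum_(u.+1 <= t < T) p (t - u)); last first.
  by rewrite (big_nat_widenl u.+1 1).
rewrite -[u.+1]add1n big_addn.
by apply: ler_sum => t _; rewrite addnK.
Qed.

(** Since [a * 224] is at most 1/4, the term in [F T] on the right of [F_le] is absorbed on the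
    left, giving a factor 4/3; then 1 + (1/4)(4/3) = 4/3. *)
Lemma sum_hit_weight T : (T <= K.+1)%N ->
  \sum_w hit_weight T w <= 4 / 3 * #|coins|%:R.
Proof.
move=> TK; have h := F_le TK.
have -> : \sum_w hit_weight T w = #|coins|%:R + a * F T.
  rewrite /F /f exchange_big/= mulr_sumr -sumr_const -big_split/=.
  by apply: eq_bigr => w _; exact: hit_weightE.
have := F_ge0 T; have n0 : 0 <= #|coins|%:R :> R by [].
have h2 : a * (224 * F T) <= 4^-1 * F T by rewrite mulrA ler_wpM2r.
have h3 : F T <= 4 / 3 * (224 * #|coins|%:R) by lra.
have h4 : a * F T <= a * (4 / 3 * (224 * #|coins|%:R)) by rewrite ler_wpM2l.
have h5 : a * 224 * #|coins|%:R <= 4^-1 * #|coins|%:R by rewrite ler_wpM2r.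
lra.
Qed.

End hits.

(** * The lower bound *)

Section levelled_walks.
Local Open Scope nat_scope.

Lemma levelled_map_iota (V : finType) (f g : nat -> V) n l :
  (forall t t', n <= t < n + l -> n <= t' < n + l -> t != t' ->
    [&& f t != f t', f t != g t', g t != f t' & g t != g t']) ->
  levelled [seq (f t, g t) | t <- iota n l].
Proof.
elim: l n => //= l IH n fg.
have rhs h h' : (forall t, n < t < n + l.+1 -> (h n != f t) && (h n != g t)) ->
    h' = h n -> h' \notin unzip1 [seq (f t, g t) | t <- iota n.+1 l] ++
      unzip2 [seq (f t, g t) | t <- iota n.+1 l].
  move=> hn ->; rewrite mem_cat negb_or /unzip1 /unzip2 -!map_comp.
  apply/andP; split; apply/mapP => -[t]; rewrite mem_iota => tn /= e.
  - by have /andP[] := hn t ltac:(lia); rewrite e eqxx.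
  - by have /andP[_] := hn t ltac:(lia); rewrite e eqxx.
apply/and3P; split.
- apply: (rhs f) => // t tn; have /and4P[-> -> _ _]// := fg n t ltac:(lia) ltac:(lia) ltac:(lia).
- apply: (rhs g) => // t tn; have /and4P[_ _ -> ->]// := fg n t ltac:(lia) ltac:(lia) ltac:(lia).
- by apply: IH => t t' tn t'n; apply: fg; lia.
Qed.

End levelled_walks.

(** * The monotone walk as a self-avoiding path of the torus *)

Section torus_walk.
Local Open Scope nat_scope.
Variables (K d m : nat).
Local Notation coins := (coins K).

Lemma displS (w : coins) t c : displ w t.+1 c = displ w t c + incr w t c.
Proof. by rewrite /displ big_ord_recr. Qed.

Lemma displ0 (w : coins) c : displ w 0 c = 0.
Proof. by rewrite /displ big_ord0. Qed.

Lemma displ_sum_le (w : coins) t : displ w t false + displ w t true <= t.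
Proof.
elim: t => [|t IH]; first by rewrite !displ0.
have : incr w t false + incr w t true <= 1.
  by rewrite /incr; case: (odd t) => /=; case: (_ < _).
by rewrite !displS; lia.
Qed.

(** The third coordinate collects the remaining times, so the coordinates sum to [t] and a position
    determines its time. *)
Definition walk (w : coins) t (c : nat) : nat :=
  match c with
  | 0 => displ w t false
  | 1 => displ w t true
  | 2 => t - (displ w t false + displ w t true)
  | _ => 0
  end.

Lemma walk_le w t c : walk w t c <= t.
Proof. by have := displ_sum_le w t; case: c => [|[|[|]]] //=; lia. Qed.

Lemma walk0 w c : walk w 0 c = 0.
Proof. by apply/eqP; rewrite -leqn0 walk_le. Qed.

Lemma walkS w t : exists2 j, j < 3 &
  forall c, walk w t.+1 c = walk w t c + (c == j).
Proof.
have hs := displ_sum_le w t.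
have [e|e] := boolP (incr w t (odd t)).
- exists (odd t); first by case: (odd t).
  have i0 : incr w t (~~ odd t) = false by rewrite /incr; case: (odd t).
  by case: (odd t) e i0 => e i0 [|[|[|c]]] //=; rewrite !displS ?e ?i0; lia.
- exists 2 => //.
  have i0 c : incr w t c = false.
    case: (eqVneq (odd t) c) e => [<- /negbTE//|ne _].
    by rewrite /incr (negbTE ne).
  by case=> [|[|[|c]]] //=; rewrite !displS !i0; lia.
Qed.

Definition shift_ord (i : 'I_m) n : 'I_m :=
  Ordinal (ltn_pmod (i + n) (leq_ltn_trans (leq0n i) (ltn_ord i))).

Lemma shift_ord_inj i n n' : n < m -> n' < m ->
  shift_ord i n = shift_ord i n' -> n = n'.
Proof.
move=> nm n'm /(congr1 val)/= /eqP; rewrite eqn_modDl !modn_small//.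
by move/eqP.
Qed.

Hypothesis hd : 3 <= d.
Variable v0 : torus d m.

Definition node (w : coins) t : torus d m :=
  [ffun c : 'I_d => shift_ord (v0 c) (walk w t c)].

Lemma node0 w : node w 0 = v0.
Proof.
apply/ffunP => c; rewrite ffunE; apply: val_inj.
by rewrite /= walk0 addn0 modn_small.
Qed.

(** Before time [m] nothing wraps around, so the coordinates, and with them their sum [t], can be
    read off the node. This gives self-avoidance and shows that two walks meet only at equal
    times. *)
Lemma node_inj w w' t t' : t < m -> t' < m -> node w t = node w' t' ->
  t = t' /\ forall c, displ w t c = displ w' t' c.
Proof.
move=> tm t'm e.
have ew c (cd : c < d) : walk w t c = walk w' t' c.
  have /ffunP/(_ (Ordinal cd)) := e; rewrite !ffunE /=; apply: shift_ord_inj.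
  - exact: leq_ltn_trans (walk_le _ _ _) tm.
  - exact: leq_ltn_trans (walk_le _ _ _) t'm.
have e0 := ew 0 (ltnW (ltnW hd)); have e1 := ew 1 (ltnW hd); have e2 := ew 2 hd.
move: e0 e1 e2 => /= e0 e1 e2; split; last by case.
by have := displ_sum_le w t; have := displ_sum_le w' t'; lia.
Qed.

Lemma node_adj w t : torus_adj (node w t) (node w t.+1).
Proof.
have [j j3 wS] := walkS w t; have jd := leq_trans j3 hd.
apply/existsP; exists (Ordinal jd); apply/andP; split.
  rewrite !ffunE/= wS eqxx addn1 addnS modn_mod -addn1 modnDml addn1.
  by rewrite eqxx.
apply/forallP => i; apply/implyP => ij; rewrite !ffunE wS.
by rewrite -(inj_eq val_inj)/= in ij; rewrite (negbTE ij) addn0.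
Qed.

Definition walk_path k (w : coins) : k.-tuple (torus d m) :=
  [tuple of map (node w) (iota 0 k)].

Lemma uniq_walk_path k w : k <= m -> uniq (walk_path k w).
Proof.
move=> km; rewrite map_inj_in_uniq ?iota_uniq// => t t'.
rewrite !mem_iota add0n => /andP[_ tk] /andP[_ t'k] /node_inj.
by move=> -[||->//]; apply: leq_trans km.
Qed.

Lemma walk_path_self_avoiding k w : 0 < k -> k <= m ->
  walk_path k w \in self_avoiding_paths (@torus_adj d m) v0 k.
Proof.
move=> k0 km; rewrite inE uniq_walk_path// andbT; apply/andP; split.
  by case: k k0 km => //= k _ _; rewrite node0.
apply/(sortedP v0) => i; rewrite size_map size_iota => ik.
rewrite !(nth_map 0) ?size_iota ?(ltnW ik)// !nth_iota ?(ltnW ik)//.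
exact: node_adj.
Qed.

End torus_walk.

Lemma exp_count (R : realType) (T : Type) (a : R) (P : pred T) (s : seq T) :
  (1 + a) ^+ count P s = \prod_(t <- s) (1 + a * (P t)%:R).
Proof.
elim: s => [|t s IH]; first by rewrite big_nil.
by rewrite big_cons -IH /=; case: (P t); rewrite ?mulr1 ?exprS// mulr0 addr0 mul1r.
Qed.

(** * Mixtures of densities over a finite index set *)

Section average.
Context (d : measure_display) (T : measurableType d) (R : realType).
Variables (mu : {measure set T -> \bar R}) (I : finType) (g : I -> T -> R).
Hypotheses (g0 : forall i x, 0 <= g i x) (mg : forall i, measurable_fun setT (g i)).
Hypothesis I0 : (0 < #|I|)%N.
Let Z : R := #|I|%:R.

Definition average (x : T) : R := Z^-1 * \sum_i g i x.

Lemma average_ge0 x : 0 <= average x.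
Proof. by rewrite mulr_ge0 ?invr_ge0// sumr_ge0. Qed.

Lemma measurable_average : measurable_fun setT average.
Proof. by apply: measurable_funM => //; exact: measurable_sum. Qed.

Lemma integral_average :
  (\int[mu]_x (average x)%:E = \sum_i Z^-1%:E * \int[mu]_x (g i x)%:E)%E.
Proof.
under eq_integral do rewrite /average mulr_sumr -sumEFin.
rewrite ge0_integral_sum//; last 2 first.
- by move=> i; apply/measurable_EFinP; exact: measurable_funM.
- by move=> i x _; rewrite lee_fin mulr_ge0// invr_ge0.
apply: eq_bigr => i _; under eq_integral do rewrite EFinM.
rewrite ge0_integralZl//.
- exact/measurable_EFinP.
- by move=> x _; rewrite lee_fin.
- by rewrite lee_fin invr_ge0.
Qed.

Lemma sum_weights : (\sum_(i : I) Z^-1%:E = 1%:E :> \bar R)%E.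
Proof.
rewrite sumEFin; congr EFin.
by rewrite sumr_const -[LHS]mulr_natl mulfV// pnatr_eq0 -lt0n.
Qed.

Lemma integral_average_eq c : (forall i, \int[mu]_x (g i x)%:E = c%:E)%E ->
  (\int[mu]_x (average x)%:E = c%:E)%E.
Proof.
move=> gc; rewrite integral_average; under eq_bigr do rewrite gc.
rewrite -ge0_sume_distrl ?sum_weights ?mul1e// => i _.
by rewrite lee_fin invr_ge0.
Qed.

Lemma integral_average_le (M : \bar R) : (0 <= M)%E ->
  (forall i, \int[mu]_x (g i x)%:E <= M)%E ->
  (\int[mu]_x (average x)%:E <= M)%E.
Proof.
move=> M0 gM; rewrite integral_average -[leRHS]mul1e -sum_weights ge0_sume_distrl.
  by apply: lee_sum => i _; rewrite lee_wpmul2l// lee_fin invr_ge0.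
by move=> i _; rewrite lee_fin invr_ge0.
Qed.

End average.

(** * The second moment method *)

Section lower_bound.
Variables (R : realType) (d m k : nat) (hd : (3 <= d)%N) (psi : R).
Variable a : R.
Hypotheses (k0 : (0 < k)%N) (km : (k <= m)%N).
Hypotheses (a01 : 0 < a <= 1) (a224 : a * 224 <= 4^-1) (psia : psi ^+ 2 <= a / 32).
Variable v0 : torus d m.
Local Notation V := (torus d m).
Local Notation coins := (coins k).
Local Notation P0 := (power_sfm (@std_gauss R) #|V|).
Local Notation S_ := (walk_path v0 k).
Local Notation L_ w := (path_density psi (S_ w)).

Let psi_lt1 : `|psi| < 1 := small_norm_lt1 a01 psia.

Let a_ge0 : 0 <= a.
Proof. by have /andP[/ltW] := a01. Qed.

(** By [node_inj] the paired walks are levelled, so [integral_pair_density] applies; the common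
    start gives the isolated factor [1 + a], and later meetings are hits. *)
Lemma integral_walk_pair (w w' : coins) :
  (\int[P0]_x (L_ w x * L_ w' x)%:E <=
   ((1 + a) * hit_weight a (displ w' : nat -> bool -> nat) k w)%:E)%E.
Proof.
pose zs := [seq (node v0 w t, node v0 w' t) | t <- iota 0 k].
have z1 : unzip1 zs = S_ w by rewrite /unzip1 /zs -map_comp.
have z2 : unzip2 zs = S_ w' by rewrite /unzip2 /zs -map_comp.
have zsE : zs = (v0, v0) :: [seq (node v0 w t, node v0 w' t) | t <- iota 1 k.-1].
  by rewrite /zs -[in iota 0 k](prednK k0) /= !node0.
have lev : levelled zs.
  apply: levelled_map_iota => t t' /andP[_ tk] /andP[_ t'k] tt'.
  have tm := leq_trans tk km; have t'm := leq_trans t'k km.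
  by apply/and4P; split; apply/eqP => /(node_inj hd tm t'm)[e _]; rewrite e eqxx in tt'.
under eq_integral do rewrite -z1 -z2 -/(pair_density psi zs _).
rewrite zsE in lev *.
apply: (le_trans (integral_pair_density psi_lt1 a01 psia lev)).
rewrite lee_fin /= {1}/meet eqxx exprS; apply: ler_wpM2l; first by rewrite addr_ge0.
rewrite exp_count big_map /hit_weight /index_iota subn1.
rewrite [leLHS]big_seq [leRHS]big_seq; apply: ler_prod => t.
rewrite mem_iota => /andP[_ tk].
have tm : (t < m)%N by apply: leq_trans km; lia.
apply/andP; split; first by rewrite addr_ge0// mulr_ge0.
rewrite lerD2l; apply: ler_wpM2l => //; rewrite ler_nat.
rewrite /meet/=; case: eqP => //= /(node_inj hd tm tm)[_ e].
by rewrite /hit; case: forallP => // -[]; move=> c; rewrite e.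
Qed.

Let Z : R := #|coins|%:R.

Let coins_gt0 : (0 < #|coins|)%N.
Proof.
rewrite card_ffun card_prod card_ord expn_gt0; apply/orP; left.
by rewrite muln_gt0 expn_gt0.
Qed.

Let Lbar : config R V -> R := average (fun w : coins => L_ w).

Let L0 (w : coins) x : 0 <= L_ w x. Proof. exact: path_density_ge0. Qed.

Let mL (w : coins) : measurable_fun setT (L_ w).
Proof. exact: measurable_path_density. Qed.

Lemma integral_Lbar : (\int[P0]_x (Lbar x)%:E = 1)%E.
Proof.
apply: integral_average_eq => // w.
by apply: integral_path_density => //; exact: uniq_walk_path.
Qed.

(** The square is a double average over two independent walks. For each fixed [w'], averaging over
    [w] gives at most [(1 + a) * (4 / 3)], which is below 2 for such small [a]. *)
Lemma integral_sqr_Lbar : (\int[P0]_x (Lbar x ^+ 2)%:E <= 2%:E)%E.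
Proof.
have -> : (fun x => (Lbar x ^+ 2)%:E) =
    (fun x => (average (fun w' : coins => average (fun (w : coins) x => L_ w x * L_ w' x)) x)%:E).
  apply/funext => x; congr EFin.
  have e (w' : coins) : average (fun (w : coins) x => L_ w x * L_ w' x) x =
      Lbar x * L_ w' x by rewrite /Lbar /average -mulrA mulr_suml.
  rewrite {1}/average; under eq_bigr do rewrite e.
  by rewrite -mulr_sumr mulrCA expr2.
have mLL (w w' : coins) : measurable_fun setT (fun x => L_ w x * L_ w' x) by exact: measurable_funM.
have LL0 (w w' : coins) x : 0 <= L_ w x * L_ w' x by rewrite mulr_ge0.
apply: integral_average_le => //.
- by move=> w' x; apply: average_ge0.
- by move=> w'; apply: measurable_average.
move=> w'; rewrite integral_average//.
apply: (@le_trans _ _ (\sum_(w : coins)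
    Z^-1%:E * ((1 + a) * hit_weight a (displ w' : nat -> bool -> nat) k w)%:E)%E).
  apply: lee_sum => w _; rewrite lee_wpmul2l ?lee_fin ?invr_ge0//.
  exact: integral_walk_pair.
under eq_bigr do rewrite -EFinM.
rewrite sumEFin lee_fin -mulr_sumr -mulr_sumr ler_pdivrMl ?ltr0n//.
have := sum_hit_weight (displ w' : nat -> bool -> nat) a_ge0 a224 (leqnSn k).
move=> h; apply: (@le_trans _ _ ((1 + a) * (4 / 3 * Z))).
  by apply: ler_wpM2l => //; rewrite addr_ge0.
rewrite mulrA mulrC; apply: ler_wpM2l; first by rewrite ler0n.
by move: a_ge0 a224; lra.
Qed.

(** The maximum over paths dominates the average over walks, so the risk is at least a Bayes risk,
    bounded below by 1 - 2/4 through the second moment. *)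
Lemma risk_lower_bound (f : {mfun config R V >-> bool}) :
  ((2^-1)%:E <= risk (self_avoiding_paths (@torus_adj d m) v0 k) psi f)%E.
Proof.
rewrite /risk.
set A := [set x | f x = true]; set B := [set x | f x = false].
set M := (X in (_ + X)%E).
have mA : measurable A.
  by rewrite -[A]setTI; exact: (measurable_funP f measurableT [set true]).
have mB : measurable B.
  by rewrite -[B]setTI; exact: (measurable_funP f measurableT [set false]).
have nullA : (@null_law R V A = \int[P0]_x (\1_A x)%:E)%E.
  by rewrite /null_law power_measureE integral_indic ?setIT.
have pathB (w : coins) : (\int[P0]_x (\1_B x * L_ w x)%:E <= M)%E.
  rewrite -path_lawE//; last exact: uniq_walk_path.
  by apply: le_bigmax_cond; exact: walk_path_self_avoiding.
have BL0 (w : coins) x : 0 <= \1_B x * L_ w x by rewrite mulr_ge0.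
have mBL (w : coins) : measurable_fun setT (fun x => \1_B x * L_ w x).
  by apply: measurable_funM => //; exact: measurable_indic.
have /card_gt0P[w0 _] := coins_gt0.
(* Some walk lies in the class, so the default [-oo] of the maximum is not attained. *)
have M0 : (0 <= M)%E.
  apply: le_trans (pathB w0); apply: integral_ge0 => x _; rewrite lee_fin.
  exact: BL0.
have avgB := integral_average_le BL0 mBL coins_gt0 M0 pathB.
have key : (1 <= (\int[P0]_x (\1_A x)%:E +
    \int[P0]_x (average (fun (w : coins) x => \1_B x * L_ w x) x)%:E) + (2^-1)%:E)%E.
  have mavg := measurable_average mBL.
  have avg0 x := average_ge0 BL0 x.
  have mLb : measurable_fun setT Lbar by exact: measurable_average.
  have Lb0 x : 0 <= Lbar x by exact: average_ge0.
  apply: (@le_trans _ _ (\int[P0]_x (\1_A x)%:E +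
    \int[P0]_x (average (fun (w : coins) x => \1_B x * L_ w x) x)%:E +
    \int[P0]_x (4^-1 * Lbar x ^+ 2)%:E)%E); last first.
    apply: leeD => //; under eq_integral do rewrite EFinM.
    rewrite ge0_integralZl//; last 2 first.
    - by apply/measurable_EFinP; exact: measurable_funX.
    - by move=> x _; rewrite lee_fin sqr_ge0.
    apply: (@le_trans _ _ (4^-1%:E * 2%:E)%E).
      by rewrite lee_wpmul2l ?lee_fin ?invr_ge0//; exact: integral_sqr_Lbar.
    by rewrite -EFinM lee_fin; lra.
  have mA1 : measurable_fun setT (\1_A : config R V -> R) by exact: measurable_indic.
  have mEA := (measurable_EFinP _ _).2 mA1.
  have mEavg := (measurable_EFinP _ _).2 mavg.
  have mEL2 : measurable_fun setT (fun x => (4^-1 * Lbar x ^+ 2)%:E).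
    by apply/measurable_EFinP; apply: measurable_funM => //; exact: measurable_funX.
  have EA0 x : (0 <= (\1_A x : R)%:E)%E by rewrite lee_fin.
  have Eavg0 x : (0 <= (average (fun (w : coins) x => \1_B x * L_ w x) x)%:E)%E.
    by rewrite lee_fin.
  have EL20 x : (0 <= (4^-1 * Lbar x ^+ 2)%:E)%E.
    by rewrite lee_fin mulr_ge0 ?invr_ge0 ?sqr_ge0.
  rewrite -ge0_integralD// -ge0_integralD//; last 2 first.
  - by move=> x _; exact: adde_ge0.
  - exact: emeasurable_funD.
  rewrite -integral_Lbar; apply: ge0_le_integral => //.
  - by move=> x _; rewrite lee_fin.
  - exact/measurable_EFinP.
  - by apply: emeasurable_funD => //; exact: emeasurable_funD.
  (* 1_A + 1_B l + l^2 / 4 >= l, the tight case being (l / 2 - 1)^2 >= 0 on A *)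
  move=> x _; rewrite -!EFinD lee_fin.
  have -> : average (fun (w : coins) x => \1_B x * L_ w x) x = \1_B x * Lbar x.
    by rewrite /average -mulr_sumr mulrCA.
  have -> : \1_A x = (f x)%:R :> R.
    by rewrite indicE; congr (nat_of_bool _)%:R; apply/idP/idP; rewrite inE.
  have -> : \1_B x = (~~ f x)%:R :> R.
    rewrite indicE; congr (nat_of_bool _)%:R; by apply/idP/idP; rewrite inE /B/=; case: (f x).
  have := Lb0 x; move: (Lbar x) => l l0.
  by have := sqr_ge0 (l - 2); case: (f x) => /=; nra.
have {}key : (1 <= (@null_law R V A + M) + (2^-1)%:E)%E.
  by apply: (le_trans key); rewrite nullA leeD2r// leeD2l.
rewrite -leeBlDr// in key; apply: le_trans key.
by rewrite -EFinB lee_fin; lra.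
Qed.

End lower_bound.

(** * The upper bound *)

Section path_count.
Local Open Scope nat_scope.

Lemma card_paths (V : finType) (e : rel V) D :
  (forall x, #|[set y | e x y]%SET| <= D) ->
  forall k x, #|[set S : k.-tuple V | path e x S]%SET| <= D ^ k.
Proof.
move=> eD; elim=> [|k IH] x; first by rewrite (leq_trans (max_card _))// card_tuple.
rewrite -sum1_card.
rewrite (reindex (fun p : V * k.-tuple V => [tuple of p.1 :: p.2])) /=; last first.
  exists (fun S : k.+1.-tuple V => (thead S, [tuple of behead S])).
  - by move=> [y S] _; congr pair; apply: val_inj.
  - by move=> S _; rewrite [RHS]tuple_eta; apply: val_inj.
rewrite (eq_bigl (fun p : V * k.-tuple V => e x p.1 && path e p.1 p.2)); last first.
  by move=> p; rewrite inE.
rewrite -(pair_big_dep (e x) (fun y (S : k.-tuple V) => path e y S) (fun _ _ => 1))/=.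
apply: (@leq_trans (\sum_(y | e x y) D ^ k)).
  by apply: leq_sum => y _; rewrite sum1dep_card.
by rewrite sum_nat_const expnS leq_mul2r -cardsE eD orbT.
Qed.

(** The first node is prescribed, so only the [k] later ones are chosen. *)
Lemma card_self_avoiding_paths (V : finType) (e : rel V) D v0 k :
  (forall x, #|[set y | e x y]%SET| <= D) ->
  #|self_avoiding_paths e v0 k.+1| <= D ^ k.
Proof.
move=> eD; apply: leq_trans (card_paths eD k v0).
pose tl (S : k.+1.-tuple V) := [tuple of behead S].
have hd S : S \in self_avoiding_paths e v0 k.+1 ->
    S = [tuple of v0 :: tl S] /\ path e v0 (tl S).
  case/tupleP: S => s S; rewrite inE => /and3P[/eqP[->] /= p _].
  by split => //; apply: val_inj.
rewrite -(card_in_imset (f := tl)); last first.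
  by move=> S S' /hd[eS _] /hd[eS' _] e'; rewrite eS eS' e'.
apply: subset_leq_card; apply/fintype.subsetP => _ /imsetP[S /hd[_ p] ->].
by rewrite inE.
Qed.

Lemma torus_degree d m (x : torus d m) : #|[set y | torus_adj x y]%SET| <= 2 * d.
Proof.
case: m x => [|m] x.
  rewrite (_ : [set y | _]%SET = finset.set0) ?cards0//.
  by apply/setP => y; rewrite !inE; apply/existsP => -[j _]; case: (x j).
(* A neighbour is coded by a coordinate and a direction; subtracting 1 modulo [m.+1] is written as
   adding [m]. *)
pose f (p : 'I_d * bool) : torus d m.+1 := [ffun i => if i == p.1 then
  (if p.2 then inord ((x i).+1 %% m.+1) else inord ((x i + m) %% m.+1)) else x i].
apply: (@leq_trans #|f @: [set: 'I_d * bool]%SET|).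
  apply: subset_leq_card; apply/fintype.subsetP => y; rewrite inE => /existsP[j /andP[yj /forallP yi]].
  have {}yi i : i != j -> y i = x i by have /implyP h := yi i => /h/eqP.
  have ylt := ltn_ord (y j).
  case/orP: yj => /eqP yj; apply/imsetP.
  - exists (j, true) => //; apply/ffunP => i; rewrite ffunE/=.
    case: eqP => [->|/eqP/yi//]; apply: val_inj.
    by rewrite /= inordK ?ltn_pmod// yj modn_small.
  - exists (j, false) => //; apply/ffunP => i; rewrite ffunE/=.
    case: eqP => [->|/eqP/yi//]; apply: val_inj.
    rewrite /= inordK ?ltn_pmod// -modnDml -yj modnDml addSnnS modnDr modn_small//.
apply: leq_trans (leq_imset_card _ _) _.
by rewrite cardsT card_prod card_ord card_bool mulnC.
Qed.

End path_count.

(** * The test that scans the likelihoods of all paths *)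

Section scan_test.
Variables (R : realType) (V : finType) (k : nat) (C : {set k.-tuple V}) (psi : R).
Hypotheses (psi1 : `|psi| < 1) (uC : forall S, S \in C -> uniq S).
Local Notation P0 := (power_sfm (@std_gauss R) #|V|).

(** A nonempty class excludes the value [-oo] of an empty maximum. *)
Lemma risk_ge0 (f : {mfun config R V >-> bool}) : C != finset.set0 ->
  (0 <= risk C psi f)%E.
Proof.
move=> /set0Pn[S SC]; rewrite /risk adde_ge0//.
  by rewrite /null_law power_measureE.
apply: (@le_trans _ _ (path_law psi S [set x | f x = false])).
  rewrite path_lawE ?uC//.
    by apply: integral_ge0 => x _; rewrite lee_fin mulr_ge0// path_density_ge0.
  by rewrite -[X in measurable X]setTI; exact: (measurable_funP f measurableT [set false]).
exact: le_bigmax_cond.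
Qed.

Variable B : R.
Hypothesis B0 : 0 < B.

Definition scan (x : config R V) : bool :=
  \big[orb/false]_(S in C) (B <= path_density psi S x).

Lemma scanP x : reflect (exists2 S, S \in C & B <= path_density psi S x) (scan x).
Proof.
rewrite /scan big_has_cond; apply: (iffP hasP) => [[S _ /andP[SC h]]|[S SC h]].
  by exists S.
by exists S; [exact: mem_index_enum|rewrite /= SC].
Qed.

Lemma measurable_scan : measurable_fun setT scan.
Proof.
rewrite /scan; elim: (index_enum _) => [|S s IH].
  rewrite (_ : (fun x => _) = cst false); first exact: measurable_cst.
  by apply/funext => x; rewrite big_nil.
have [SC|SC] := boolP (S \in C); last first.
  by rewrite [X in measurable_fun _ X](_ : _ = fun x =>
    \big[orb/false]_(S <- s | S \in C) (B <= path_density psi S x))//;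
  apply/funext => x; rewrite big_cons (negbTE SC).
rewrite [X in measurable_fun _ X](_ : _ = fun x => (B <= path_density psi S x) ||
  \big[orb/false]_(S <- s | S \in C) (B <= path_density psi S x)).
  apply: measurable_or => //.
  by apply: measurable_fun_ler => //; exact: measurable_path_density.
by apply/funext => x; rewrite big_cons SC.
Qed.

HB.instance Definition _ := isMeasurableFun.Build _ _ _ _ scan measurable_scan.

(** Type I: a union bound with Markov's inequality, each likelihood having null mean 1. Type II:
    where the test accepts, [L_S <= B], hence [L_S] is at most [sqrt B * sqrt L_S]. *)
Lemma risk_scan_le : (risk C psi scan <=
  (#|C|%:R / B + Num.sqrt B * sqrt_bound psi ^+ k.-1)%:E)%E.
Proof.
rewrite /risk EFinD; apply: leeD.
- have mA : measurable [set x | scan x = true].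
    by rewrite -[X in measurable X]setTI; exact: (measurable_scan measurableT (Y := [set true])).
  rewrite /null_law power_measureE -[X in power_sfm _ _ X]setIT -integral_indic//.
  apply: (@le_trans _ _ (\int[P0]_x (\sum_(S <- enum C) (B^-1 * path_density psi S x)%:E))%E).
    apply: ge0_le_integral => //.
    - by apply/measurable_EFinP; exact: measurable_indic.
    - apply: emeasurable_sum => S; apply/measurable_EFinP; apply: measurable_funM => //.
      exact: measurable_path_density.
    move=> x _; rewrite sumEFin big_enum lee_fin indicE.
    have sum0 : 0 <= \sum_(S in C) B^-1 * path_density psi S x.
      by apply: sumr_ge0 => S _; rewrite mulr_ge0 ?invr_ge0 ?path_density_ge0// ltW.
    have [|xA] := boolP (x \in _); last exact: sum0.
    rewrite inE => /= /scanP[S SC BS].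
    rewrite (bigD1 S)//= -[leLHS]addr0; apply: lerD.
      by rewrite ler_pdivlMl// mulr1.
    by apply: sumr_ge0 => S' _; rewrite mulr_ge0 ?invr_ge0 ?path_density_ge0// ltW.
  rewrite ge0_integral_sum//; last 2 first.
  - move=> S; apply/measurable_EFinP; apply: measurable_funM => //.
    exact: measurable_path_density.
  - by move=> S x _; rewrite lee_fin mulr_ge0 ?invr_ge0 ?path_density_ge0// ltW.
  rewrite big_enum (eq_bigr (fun=> B^-1%:E)) => [|S SC].
    by rewrite sumEFin lee_fin sumr_const mulr_natl.
  under eq_integral do rewrite EFinM.
  rewrite ge0_integralZl//; last 3 first.
  - by apply/measurable_EFinP; exact: measurable_path_density.
  - by move=> x _; rewrite lee_fin path_density_ge0.
  - by rewrite lee_fin invr_ge0 ltW.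
  by rewrite (integral_path_density psi1 (uC SC)) mule1.
- apply: bigmax_le => [|S SC]; first exact: leNye.
  have mB : measurable [set x | scan x = false].
    by rewrite -[X in measurable X]setTI; exact: (measurable_scan measurableT (Y := [set false])).
  rewrite path_lawE ?uC//.
  apply: (@le_trans _ _ (\int[P0]_x ((Num.sqrt B)%:E * (Num.sqrt (path_density psi S x))%:E))%E).
    apply: ge0_le_integral => //.
    - by move=> x _; rewrite lee_fin mulr_ge0// path_density_ge0.
    - apply/measurable_EFinP; apply: measurable_funM; first exact: measurable_indic.
      exact: measurable_path_density.
    - apply: emeasurable_funM => //; apply/measurable_EFinP.
      by apply: measurableT_comp; [exact: measurable_sqrtr|exact: measurable_path_density].
    move=> x _; rewrite -EFinM lee_fin indicE.
    have [|xA] := boolP (x \in _); last by rewrite mul0r mulr_ge0 ?sqrtr_ge0.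
    rewrite inE => /= /scanP scanx; rewrite mul1r.
    have LB : path_density psi S x <= B.
      by rewrite leNgt; apply/negP => /ltW h; apply: scanx; exists S.
    have L0 := path_density_ge0 psi S x.
    rewrite -[leLHS](sqr_sqrtr L0) expr2; apply: ler_wpM2r; first exact: sqrtr_ge0.
    exact: ler_wsqrtr.
  rewrite ge0_integralZl//; last first.
  - apply/measurable_EFinP.
    by apply: measurableT_comp; [exact: measurable_sqrtr|exact: measurable_path_density].
  rewrite EFinM; apply: lee_wpmul2l; first by rewrite lee_fin sqrtr_ge0.
  have := integral_sqrt_path_density psi1 (uC SC).
  by rewrite size_tuple.
Qed.

End scan_test.

Lemma sqrtrX (R : rcfType) (x : R) n : 0 <= x -> Num.sqrt (x ^+ n) = Num.sqrt x ^+ n.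
Proof.
by move=> x0; elim: n => [|n IH]; rewrite ?sqrtr1// !exprS sqrtrM// IH.
Qed.

Lemma limn_einf_ge (R : realType) (u : (\bar R)^nat) (c : \bar R) n :
  (forall k, (n <= k)%N -> c <= u k)%E -> (c <= limn_einf u)%E.
Proof.
move=> cu; rewrite limn_einf_lim (cvg_lim _ (@cvg_einfs_sup _ u))//.
apply: le_trans (ereal_sup_ubound (ex_intro2 _ _ n I erefl)).
by apply: le_ereal_inf_tmp => _ [k nk <-]; exact: cu.
Qed.

Section minimax_upper_bound.
Variables (R : realType) (d m : nat) (psi : R) (v0 : torus d m).
Hypotheses (hd : (3 <= d)%N) (psi1 : `|psi| < 1).
Hypothesis psi_large : 1 - psi ^+ 2 <= (32 * d%:R)^-1 ^+ 2.
Local Notation paths k := (self_avoiding_paths (@torus_adj d m) v0 k).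

Lemma self_avoiding_paths_uniq k S : S \in paths k -> uniq S.
Proof. by rewrite inE => /and3P[]. Qed.

Lemma self_avoiding_paths_neq0 k : (k < m)%N -> paths k.+1 != finset.set0.
Proof.
move=> km; apply/set0Pn.
have /card_gt0P[w _] : (0 < #|coins 0|)%N.
  by rewrite card_ffun card_prod card_ord expn_gt0 muln_gt0 expn_gt0.
by exists (walk_path v0 k.+1 w); exact: walk_path_self_avoiding.
Qed.

(** The constant 32 is chosen here: the quantity under the outer root becomes
    [4 d * 2 / (32 d) = 1 / 4]. *)
Lemma sqrt_bound_small : Num.sqrt (4 * d%:R) * sqrt_bound psi <= 2^-1.
Proof.
have d0 : 0 < d%:R :> R by rewrite ltr0n (leq_trans _ hd).
have h1 : Num.sqrt (1 - psi ^+ 2) <= (32 * d%:R)^-1.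
  apply: (le_trans (ler_wsqrtr psi_large)).
  by rewrite sqrtr_sqr ger0_norm// invr_ge0 mulr_ge0// ltW.
have h2 := ler_wsqrtr h1.
rewrite /sqrt_bound mulrA -sqrtrM ?mulr_ge0 ?(ltW d0)//.
apply: (@le_trans _ _ (Num.sqrt (4 * d%:R * 2) * Num.sqrt ((32 * d%:R)^-1))).
  by apply: ler_wpM2l => //; exact: sqrtr_ge0.
rewrite -sqrtrM ?mulr_ge0 ?(ltW d0)//.
have -> : 4 * d%:R * 2 * (32 * d%:R)^-1 = 2^-1 ^+ 2 :> R.
  by field; rewrite gt_eqF.
by rewrite sqrtr_sqr ger0_norm// invr_ge0.
Qed.

(** The threshold is [(4 d) ^ n.+1]. At most [(2 d) ^ n] paths give a type I error below [2 ^- n],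
    and each of the [n] edges contributes [sqrt (4 d) * kappa <= 1 / 2] to the type II error, with
    one factor [sqrt (4 d)] left over. *)
Lemma minimax_risk_le n :
  (minimax_risk (paths n.+1) psi <=
   (geometric (1 + Num.sqrt (4 * d%:R)) 2^-1 n)%:E)%E.
Proof.
have d0 : 0 < d%:R :> R by rewrite ltr0n (leq_trans _ hd).
pose b : R := 4 * d%:R; have b0 : 0 < b by rewrite mulr_gt0.
have uC := @self_avoiding_paths_uniq n.+1.
have B0 : 0 < b ^+ n.+1 by rewrite exprn_gt0.
pose f : {mfun config R (torus d m) >-> bool} := scan (paths n.+1) psi (b ^+ n.+1).
apply: (@le_trans _ _ (risk (paths n.+1) psi f)).
  by apply: ereal_inf_lbound; exists f.
apply: (le_trans (risk_scan_le psi1 uC B0)).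
rewrite lee_fin /geometric/= mulrDl mul1r; apply: lerD.
  have cC : #|paths n.+1|%:R <= (2 * d%:R) ^+ n :> R.
    rewrite -natrM -natrX ler_nat; apply: card_self_avoiding_paths => x.
    exact: torus_degree.
  rewrite ler_pdivrMr//; apply: (le_trans cC).
  rewrite exprS mulrCA -exprMn (_ : 2^-1 * b = 2 * d%:R); last by rewrite /b; field.
  by rewrite ler_peMl ?exprn_ge0 ?mulr_ge0// /b -natrM ler1n muln_gt0 (leq_trans _ hd).
rewrite sqrtrX ?(ltW b0)// exprS -mulrA -exprMn; apply: ler_wpM2l.
  exact: sqrtr_ge0.
apply: lerXn2r; rewrite ?nnegrE ?mulr_ge0 ?sqrtr_ge0//.
exact: sqrt_bound_small.
Qed.

Lemma minimax_risk_ge0 n : (n < m)%N -> (0 <= minimax_risk (paths n.+1) psi)%E.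
Proof.
move=> nm; apply: le_ereal_inf_tmp => _ [f _ <-].
apply: risk_ge0 => //; last exact: self_avoiding_paths_neq0.
exact: self_avoiding_paths_uniq.
Qed.

End minimax_upper_bound.

Theorem corollary1 (R : realType) (d : nat) (hd : (3 <= d)%N) :
  exists C1 C2 : R,
    [/\ 0 < C1, C1 <= C2, C2 < 1 &
      forall (psi : R) (hpsi : -1 < psi < 1)
             (m : nat -> nat) (hm : forall k, (k <= m k)%N)
             (v0 : forall k, torus d (m k)),
        let Rstar k :=
          minimax_risk (self_avoiding_paths (@torus_adj d (m k)) (v0 k) k) psi in
        (`|psi| < C1 -> (0 < limn_einf Rstar)%E) /\
        (C2 < `|psi| -> Rstar k @[k --> \oo] --> 0%E)].
Proof.
pose e : R := (32 * d%:R)^-1 ^+ 2.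
have d1 : 1 <= d%:R :> R by rewrite ler1n (leq_trans _ hd).
have e0 : 0 < e by rewrite exprn_gt0// invr_gt0 mulr_gt0// (lt_le_trans ltr01).
have e1 : e <= 2^-1.
  apply: (@le_trans _ _ (2^-1 ^+ 2)); last by lra.
  apply: lerXn2r; rewrite ?nnegrE ?invr_ge0 ?mulr_ge0// lef_pV2 ?posrE//; lra.
(* With [a = 1 / 1024], [a * 224 <= 1 / 4] and [psi ^+ 2 <= 256 ^- 2 <= a / 32]. For large [|psi|],
   [1 - psi ^+ 2] is at most [2 * (1 - |psi|)], hence below [e]. *)
exists 256^-1, (1 - e / 2); split; [by rewrite invr_gt0|lra|lra|].
move=> psi hpsi m hm v0 Rstar.
have psi1 : `|psi| < 1 by rewrite ltr_norml.
have psi2 : psi ^+ 2 = `|psi| ^+ 2 by rewrite real_normK ?num_real.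
split => hC.
- apply: (@lt_le_trans _ _ (2^-1)%:E); first by rewrite lte_fin.
  apply: (@limn_einf_ge _ _ _ 1) => k k0.
  apply: le_ereal_inf_tmp => _ [f _ <-].
  apply: (@risk_lower_bound _ _ _ _ hd _ 1024^-1) => //.
  + by apply/andP; split; lra.
  + by lra.
  + rewrite psi2; apply: (@le_trans _ _ (256^-1 ^+ 2)); last by lra.
    by apply: lerXn2r; rewrite ?nnegrE// ltW.
- have large : 1 - psi ^+ 2 <= (32 * d%:R)^-1 ^+ 2.
    by rewrite psi2 -/e; have := normr_ge0 psi; nra.
  (* The upper bound is stated for [n.+1] nodes, so the sequence is shifted by one. *)
  rewrite -(cvg_shiftS Rstar).
  apply: (@squeeze_cvge _ _ _ _ (fun=> 0%E) _
    (fun n => (geometric (1 + Num.sqrt (4 * d%:R)) 2^-1 n)%:E) _ 0%E).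
  + apply: nearW => n; apply/andP; split.
      exact: minimax_risk_ge0.
    exact: minimax_risk_le.
  + exact: cvg_cst.
  + apply: cvg_EFin; first by apply: nearW.
    by apply: cvg_geometric; rewrite ger0_norm ?invr_ge0// invf_lt1// ltr1n.
Qed.
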